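(* There are separable Hilbertian operator spaces $X$ and $Y$ such that $X$ completely isometrically embeds into $c_0(Y)$, but $X$ does not completely isomorphically embed into $Y$.
   Context: An operator space is Hilbertian if it is isomorphic, as a Banach space, to $\ell_2$. $c_0(Y)$ is the space of sequences $(y_n)_{n\in\mathbb{N}}$ in $Y$ with $\|y_n\|\to0$, with operator space structure $\|[x_{ij}]\|_{\mathrm{M}_k(c_0(Y))}=\sup_n\|[x_{ij}(n)]\|_{\mathrm{M}_k(Y)}$. A complete isomorphic embedding is a completely bounded injective linear map whose inverse, defined on its image, is completely bounded; a complete isometric embedding is a linear map all of whose matrix amplifications are isometric. *)

(* Defs.v *)
From HB Require Import structures.
From mathcomp Require Import all_boot all_order all_algebra.
From mathcomp Require Import sesquilinear complex.
From mathcomp Require Import all_classical all_reals all_analysis.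
From mathcomp Require Import lra.

Set Implicit Arguments.
Unset Strict Implicit.
Unset Printing Implicit Defensive.

Import Order.TTheory GRing.Theory Num.Theory.
Import numFieldNormedType.Exports.

Local Open Scope classical_set_scope.
Local Open Scope ring_scope.
Local Open Scope complex_scope.

(* The norm of a normed space over [R[i]] takes its values in [R[i]];
   [rnorm] is the same norm read as an element of [R]. *)
Definition rnorm (R : realType) (V : normedModType R[i]) (x : V) : R :=
  complex.Re `|x|.

Definition separable (T : topologicalType) : Prop :=
  exists2 D : set T, countable D & dense D.

Record hilbertSpace (R : realType) := HilbertSpace {
  hs_carrier :> completeNormedModType R[i] ;
  hs_dot : {dot hs_carrier for Num.conj} ;
  hs_dotE : forall x : hs_carrier, `|x| ^+ 2 = hs_dot x x }.

(* The norm of the Hilbert space direct sum of [k] copies of [H]. *)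
Definition hsum_norm (R : realType) (H : hilbertSpace R) (k : nat)
  (h : 'cV[H]_k) : R := Num.sqrt (\sum_i rnorm (h i 0) ^+ 2).

(* An operator space is a closed subspace of some B(H).  It is given here as a
   Banach space together with a linear isometry onto its copy in B(H); the
   image is closed because the Banach space is complete. *)
Record opSpace (R : realType) := OpSpace {
  os_carrier :> completeNormedModType R[i] ;
  os_hilbert : hilbertSpace R ;
  os_op : os_carrier -> {linear os_hilbert -> os_hilbert} ;
  os_op_continuous : forall x, continuous (os_op x) ;
  os_op_linear : forall (a : R[i]) (x y : os_carrier) (h : os_hilbert),
    os_op (a *: x + y) h = a *: os_op x h + os_op y h ;
  os_op_isometry : forall x : os_carrier,
    rnorm x = sup [set rnorm (os_op x h) | h in [set h | rnorm h <= 1]] }.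

(* A square matrix with entries in [X], seen as an operator on the direct sum
   of [k] copies of the Hilbert space on which [X] acts. *)
Definition os_ampl (R : realType) (X : opSpace R) (k : nat) (x : 'M[X]_k)
  (h : 'cV[os_hilbert X]_k) : 'cV[os_hilbert X]_k :=
  \col_i \sum_j os_op (x i j) (h j 0).

Definition mxnorms (R : realType) (V : lmodType R[i]) : Type :=
  forall k : nat, 'M[V]_k -> R.

Definition os_norm (R : realType) (X : opSpace R) : mxnorms X :=
  fun k x =>
    sup [set hsum_norm (os_ampl x h) | h in [set h | hsum_norm h <= 1]].

Section C0.
Variables (R : realType) (Y : normedModType R[i]).

Definition c0_pred : {pred (nat -> Y)} :=
  fun y => `[< y n @[n --> \oo] --> (0 : Y) >].

Lemma c0_submod_closed : submod_closed c0_pred.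
Proof.
split=> [|a y z /asboolP y0 /asboolP z0]; apply/asboolP; first exact: cvg_cst.
rewrite (_ : 0 = a *: (0 : Y) + 0); last by rewrite scaler0 addr0.
by apply: cvgD => //; exact: cvgZl_tmp.
Qed.

HB.instance Definition _ :=
  GRing.isSubmodClosed.Build R[i] (nat -> Y) c0_pred c0_submod_closed.

Record c0 : Type := C0 { c0_val :> nat -> Y ; _ : c0_val \in c0_pred }.

HB.instance Definition _ := [isSub for c0_val].
HB.instance Definition _ := [Choice of c0 by <:].
HB.instance Definition _ := [SubChoice_isSubLmodule of c0 by <:].

End C0.

Definition c0_norm (R : realType) (Y : opSpace R) : mxnorms (c0 Y) :=
  fun k x =>
    sup (range (fun n : nat => os_norm (map_mx (fun y : c0 Y => y n) x))).

Section Ell2.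
Variable R : realType.

Definition ell2_sum (a : nat -> R[i]^o) : \bar R :=
  (\sum_(n <oo) (rnorm (a n) ^+ 2)%:E)%E.

Definition ell2_pred : {pred (nat -> R[i]^o)} :=
  fun a => `[< (ell2_sum a < +oo)%E >].

Lemma rnormE (z : R[i]^o) : (rnorm z)%:C = `|z|.
Proof. by rewrite /rnorm normc_def. Qed.

Lemma ell2_term_ge0 (a : nat -> R[i]^o) n : (0 <= (rnorm (a n) ^+ 2)%:E)%E.
Proof. by rewrite lee_fin sqr_ge0. Qed.

Lemma ell2_term_le (c y z : R[i]^o) :
  rnorm (c *: y + z) ^+ 2 <=
  (2 * rnorm c ^+ 2) * rnorm y ^+ 2 + 2 * rnorm z ^+ 2.
Proof.
have r0 (w : R[i]^o) : 0 <= rnorm w.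
  by rewrite -(lecR 0) rnormE normr_ge0.
have le1 : rnorm (c *: y + z) <= rnorm c * rnorm y + rnorm z.
  rewrite -lecR rmorphD rmorphM /= !rnormE -normrM.
  exact: ler_normD.
have := r0 (c *: y + z); have := mulr_ge0 (r0 c) (r0 y); have := r0 z.
move: le1; set p := rnorm c * rnorm y; set q := rnorm z; set w := rnorm _.
rewrite -mulrA -exprMn -/p => le1 q0 p0 w0.
apply: (@le_trans _ _ ((p + q) ^+ 2)); first by rewrite ler_sqr ?nnegrE ?addr_ge0.
have := sqr_ge0 (p - q); rewrite sqrrB sqrrD; lra.
Qed.

Lemma ell2_submod_closed : submod_closed ell2_pred.
Proof.
split=> [|c y z /asboolP ysum /asboolP zsum]; apply/asboolP.
  rewrite /ell2_sum eseries0 ?ltry// => n _ _.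
  by rewrite /rnorm normr0 expr0n.
pose r := rnorm (c : R[i]^o).
pose Y n : \bar R := (rnorm (y n) ^+ 2)%:E.
pose Z n : \bar R := (rnorm (z n) ^+ 2)%:E.
have le_sum : (ell2_sum (c *: y + z)%R
    <= \sum_(n <oo) ((2 * r ^+ 2)%R%:E * Y n + 2%:E * Z n))%E.
  apply: lee_nneseries => [n _ _|n _ /=]; first exact: ell2_term_ge0.
  by rewrite -!EFinM -EFinD lee_fin; exact: ell2_term_le.
apply: (le_lt_trans le_sum).
have k0 : 0 <= 2 * r ^+ 2 by rewrite mulr_ge0 ?sqr_ge0.
have Y0 n : (0 <= Y n)%E by exact: ell2_term_ge0.
have Z0 n : (0 <= Z n)%E by exact: ell2_term_ge0.
rewrite nneseriesD; last 2 first.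
- by move=> n _ _; apply: mule_ge0 => //; rewrite lee_fin.
- by move=> n _ _; apply: mule_ge0 => //; rewrite lee_fin.
rewrite !nneseriesZl//.
have fY : (\sum_(n <oo) Y n)%E \is a fin_num.
  by rewrite ge0_fin_numE// nneseries_ge0.
have fZ : (\sum_(n <oo) Z n)%E \is a fin_num.
  by rewrite ge0_fin_numE// nneseries_ge0.
by rewrite -(fineK fY) -(fineK fZ) -!EFinM -EFinD ltry.
Qed.

HB.instance Definition _ :=
  GRing.isSubmodClosed.Build R[i] (nat -> R[i]^o) ell2_pred ell2_submod_closed.

Record ell2 : Type := Ell2 {
  ell2_val :> nat -> R[i]^o ; _ : ell2_val \in ell2_pred }.

HB.instance Definition _ := [isSub for ell2_val].
HB.instance Definition _ := [Choice of ell2 by <:].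
HB.instance Definition _ := [SubChoice_isSubLmodule of ell2 by <:].

Definition ell2_norm (a : ell2) : R := Num.sqrt (fine (ell2_sum a)).

End Ell2.

Definition hilbertian (R : realType) (X : opSpace R) : Prop :=
  exists f : {linear X -> ell2 R},
    [/\ bijective f,
        exists K : R, forall x, ell2_norm (f x) <= K * rnorm x &
        exists K : R, forall x, rnorm x <= K * ell2_norm (f x)].

Section CompleteEmbeddings.
Variables (R : realType) (V W : lmodType R[i]).
Variables (NV : mxnorms V) (NW : mxnorms W).

Definition completely_bounded_on (D : set V) (f : V -> W) : Prop :=
  exists K : R, forall (k : nat) (x : 'M[V]_k),
    (forall i j, D (x i j)) -> NW (map_mx f x) <= K * NV x.

Definition complete_isometry (f : V -> W) : Prop :=
  forall (k : nat) (x : 'M[V]_k), NW (map_mx f x) = NV x.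

End CompleteEmbeddings.

Definition completely_isometrically_embeds (R : realType) (V W : lmodType R[i])
  (NV : mxnorms V) (NW : mxnorms W) : Prop :=
  exists f : {linear V -> W}, complete_isometry NV NW f.

Definition completely_isomorphically_embeds (R : realType)
  (V W : lmodType R[i]) (NV : mxnorms V) (NW : mxnorms W) : Prop :=
  exists f : {linear V -> W},
    [/\ injective f, completely_bounded_on NV NW setT f &
        exists2 g : W -> V, cancel f g &
          completely_bounded_on NW NV (range f) g].

(* Main.v *)
Require Import Defs.
From HB Require Import structures.
From mathcomp Require Import all_boot all_order all_algebra.
From mathcomp Require Import sesquilinear spectral complex.
From mathcomp Require Import all_classical all_reals all_analysis.
From mathcomp Require Import ring lra.

Set Implicit Arguments.
Unset Strict Implicit.
Unset Printing Implicit Defensive.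

Import Order.TTheory GRing.Theory Num.Theory.
Import numFieldNormedType.Exports.

Local Open Scope classical_set_scope.
Local Open Scope ring_scope.
Local Open Scope complex_scope.

(* Both spaces are l_2 with the column structure intersected with weighted row
   structures.  Let a_n > 0 decrease to 0, constant on long blocks with ratios
   between consecutive blocks tending to infinity.  For x = (x_n), let
   ||x||_Y = max(||x||_C, ||(a_n x_{2n})_n||_R) and
   ||x||_X = max(||x||_Y, ||(a_n x_{2n+1})_n||_R) at every matrix level; X embeds
   in c_0(Y) by x |-> (x, Ux, 0, ...), where U swaps x_{2n} and x_{2n+1}.
   If f : X -> Y were a complete isomorphic embedding, then a subspace of
   dimension at least S of the span of the first 2S coordinates of X would be
   mapped by f to vectors whose coordinates 2n vanish for n < S.  On an
   orthonormal basis of that subspace, placed in a row, the norm of X sees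
   weights at least a_{S-1}, whereas the norm of Y of the image sees only weights
   at most a_S; if S is the end of a late block this is a contradiction. *)

(** * Real-valued norms, complex scalars and inequalities for finite sums *)

Lemma cvgn_unique (K : numFieldType) (V : pseudoMetricNormedZmodType K)
  (u : nat -> V) (a b : V) :
  u n @[n --> \oo] --> a -> u n @[n --> \oo] --> b -> a = b.
Proof. exact: norm_cvg_unique. Qed.

Section RealNorm.
Context {R : realType}.

Lemma rnorm_normE (V : normedModType R[i]) (x : V) : (rnorm x)%:C = `|x|.
Proof. exact/RRe_real/ger0_real/normr_ge0. Qed.

Lemma rnorm_ge0 (V : normedModType R[i]) (x : V) : 0 <= rnorm x.
Proof. by rewrite -(lecR 0) rnorm_normE normr_ge0. Qed.

Lemma rnorm0 (V : normedModType R[i]) : rnorm (0 : V) = 0.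
Proof. by rewrite /rnorm normr0. Qed.

Lemma rnormD (V : normedModType R[i]) (x y : V) :
  rnorm (x + y) <= rnorm x + rnorm y.
Proof. by rewrite -lecR rmorphD /= !rnorm_normE ler_normD. Qed.

Lemma rnormZ (V : normedModType R[i]) (c : R[i]) (x : V) :
  rnorm (c *: x) = rnorm (c : R[i]^o) * rnorm x.
Proof. by apply: complexI; rewrite rmorphM /= !rnorm_normE normrZ. Qed.

Lemma rnorm_sum (V : normedModType R[i]) I (s : seq I) (F : I -> V) :
  rnorm (\sum_(i <- s) F i) <= \sum_(i <- s) rnorm (F i).
Proof.
elim/big_rec2: _ => [|i x y _ le_yx]; first by rewrite rnorm0.
exact: le_trans (rnormD _ _) (lerD _ _).
Qed.

(** Comparable elements of [R[i]] have equal imaginary parts, so a positive radius is real.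
    Convergence and Cauchy conditions over [R[i]] thereby reduce to real radii. *)
Lemma complex_gt0 (e : R[i]) : 0 < e -> exists2 r : R, 0 < r & e = r%:C.
Proof.
move=> e0; exists (complex.Re e); last by rewrite RRe_real// gtr0_real.
by rewrite -ltcR RRe_real// gtr0_real.
Qed.

Lemma rnorm_cvgP (V : normedModType R[i]) T (F : set_system T) (FF : Filter F)
  (f : T -> V) (y : V) :
  f x @[x --> F] --> y <->
  forall r : R, 0 < r -> \forall x \near F, rnorm (y - f x) < r.
Proof.
split=> [/cvgrPdist_lt fy r r0|fy]; last apply/cvgrPdist_lt => _
  /complex_gt0[r r0 ->].
  have r0' : 0 < r%:C by rewrite ltcR.
  by apply: filterS (fy _ r0') => x; rewrite -rnorm_normE ltcR.
by apply: filterS (fy _ r0) => x; rewrite -rnorm_normE ltcR.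
Qed.

Lemma rnorm_cauchy (V : normedModType R[i]) (F : set_system V) (FF : Filter F) :
  cauchy F -> forall r : R, 0 < r -> \forall x & y \near F, rnorm (x - y) < r.
Proof.
move=> /cauchy_ballP Fc r r0.
have r0' : 0 < r%:C by rewrite ltcR.
apply: filterS (Fc _ r0') => -[x y] /=.
by rewrite -ball_normE /ball_ /= -rnorm_normE ltcR.
Qed.

Definition sqn (z : R[i]) : R := rnorm (z : R[i]^o) ^+ 2.

Lemma sqnE z : sqn z = complex.Re z ^+ 2 + complex.Im z ^+ 2.
Proof.
by apply: complexI; rewrite add_Re2_Im2 /sqn rmorphXn /= rnorm_normE.
Qed.

Lemma sqn_ge0 z : 0 <= sqn z. Proof. exact: sqr_ge0. Qed.

Lemma sqn0 : sqn 0 = 0. Proof. by rewrite /sqn rnorm0 expr0n. Qed.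

Lemma sqnM z w : sqn (z * w) = sqn z * sqn w.
Proof. by rewrite /sqn -exprMn -rnormZ. Qed.

Lemma sqn_opp z : sqn (- z) = sqn z.
Proof. by rewrite -mulN1r sqnM sqnE /= sqrrN expr1n oppr0 expr0n addr0 mul1r. Qed.

Lemma sqn_conj z : sqn z^* = sqn z.
Proof. by case: z => a b; rewrite !sqnE /= sqrrN. Qed.

Lemma rnorm_conj z : rnorm (z^* : R[i]^o) = rnorm (z : R[i]^o).
Proof. by rewrite /rnorm !normc_def; case: z => a b /=; rewrite sqrrN. Qed.

Lemma mulcJ z : z * z^* = (sqn z)%:C.
Proof.
by case: z => a b; rewrite sqnE; apply/eqP; rewrite eq_complex /=;
   apply/andP; split; apply/eqP; ring.
Qed.

Lemma sqn_real (r : R) : sqn r%:C = r ^+ 2.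
Proof. by rewrite sqnE /= expr0n addr0. Qed.

Lemma Re_le_rnorm z : `|complex.Re z| <= rnorm (z : R[i]^o).
Proof.
rewrite -ler_sqr ?nnegrE ?rnorm_ge0// real_normK ?num_real//.
by rewrite -/(sqn z) sqnE lerDl sqr_ge0.
Qed.

Lemma Im_le_rnorm z : `|complex.Im z| <= rnorm (z : R[i]^o).
Proof.
rewrite -ler_sqr ?nnegrE ?rnorm_ge0// real_normK ?num_real//.
by rewrite -/(sqn z) sqnE lerDr sqr_ge0.
Qed.

Lemma rnorm_le_ReIm z :
  rnorm (z : R[i]^o) <= `|complex.Re z| + `|complex.Im z|.
Proof.
rewrite -ler_sqr ?nnegrE ?rnorm_ge0 ?addr_ge0// -/(sqn z) sqnE sqrrD.
by rewrite !real_normK ?num_real// lerD2r lerDl mulrn_wge0 ?mulr_ge0.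
Qed.

Lemma cvg_complex T (F : set_system T) (FF : Filter F) (f : T -> R[i]^o) (a b : R) :
  complex.Re (f x) @[x --> F] --> a -> complex.Im (f x) @[x --> F] --> b ->
  f x @[x --> F] --> (a +i* b : R[i]^o).
Proof.
move=> /cvgrPdist_lt fa /cvgrPdist_lt fb; apply/rnorm_cvgP => r r0.
have r20 : 0 < r / 2 by rewrite divr_gt0.
near=> x; apply: le_lt_trans (rnorm_le_ReIm _) _.
rewrite [r]splitr ltrD//.
  by case: (f x) (near (fa _ r20) x) => u v /=; apply.
by case: (f x) (near (fb _ r20) x) => u v /=; apply.
Unshelve. all: by end_near. Qed.

Lemma CauchySchwarz_sum I (s : seq I) (f g : I -> R) :
  (\sum_(i <- s) f i * g i) ^+ 2 <=
  (\sum_(i <- s) f i ^+ 2) * (\sum_(i <- s) g i ^+ 2).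
Proof.
suff [] : [/\ 0 <= \sum_(i <- s) f i ^+ 2, 0 <= \sum_(i <- s) g i ^+ 2 &
  (\sum_(i <- s) f i * g i) ^+ 2 <=
  (\sum_(i <- s) f i ^+ 2) * (\sum_(i <- s) g i ^+ 2)] by [].
elim/big_rec3: _ => [|i S Q P _ [P0 Q0 SPQ]]; first by split; rewrite ?expr0n ?mul0r.
split; rewrite ?addr_ge0 ?sqr_ge0//.
move: (f i) (g i) => a b {f g}.
(* After expanding, the induction step needs only this arithmetic-geometric mean inequality. The
   difference of the squares of its two sides is [(P * b ^+ 2 - Q * a ^+ 2) ^+ 2] plus
   [4 * ((P * Q - S ^+ 2) * (a * b) ^+ 2)]. *)
suff key : 2 * (S * (a * b)) <= P * b ^+ 2 + Q * a ^+ 2.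
  rewrite -subr_ge0 [leRHS](_ : _ = P * b ^+ 2 + Q * a ^+ 2 -
    2 * (S * (a * b)) + (P * Q - S ^+ 2)); last by ring.
  by rewrite addr_ge0// subr_ge0.
apply: le_trans (ler_norm _) _.
rewrite -ler_sqr ?nnegrE//; last first.
  by apply: addr_ge0; apply: mulr_ge0 => //; exact: sqr_ge0.
rewrite real_normK ?num_real// -subr_ge0.
rewrite [leRHS](_ : _ = (P * b ^+ 2 - Q * a ^+ 2) ^+ 2 +
  4 * ((P * Q - S ^+ 2) * (a * b) ^+ 2)); last by ring.
by rewrite addr_ge0 ?sqr_ge0// mulr_ge0// mulr_ge0 ?sqr_ge0// subr_ge0.
Qed.

Lemma CauchySchwarz_csum I (s : seq I) (f g : I -> R[i]) :
  sqn (\sum_(i <- s) f i * g i) <=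
  (\sum_(i <- s) sqn (f i)) * (\sum_(i <- s) sqn (g i)).
Proof.
apply: le_trans (CauchySchwarz_sum s (fun i => rnorm (f i : R[i]^o))
  (fun i => rnorm (g i : R[i]^o))).
rewrite ler_sqr ?nnegrE ?rnorm_ge0 ?sumr_ge0//; last first.
  by move=> i _; rewrite mulr_ge0 ?rnorm_ge0.
apply: le_trans (rnorm_sum _ _) _.
by apply: ler_sum => i _; rewrite -rnormZ.
Qed.

Lemma Minkowski_sum I (s : seq I) (f g : I -> R[i]) (p q : R) :
  0 <= p -> 0 <= q ->
  \sum_(i <- s) sqn (f i) <= p ^+ 2 -> \sum_(i <- s) sqn (g i) <= q ^+ 2 ->
  \sum_(i <- s) sqn (f i + g i) <= (p + q) ^+ 2.
Proof.
move=> p0 q0 fp gq.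
pose F i := rnorm (f i : R[i]^o); pose G i := rnorm (g i : R[i]^o).
have FG0 : 0 <= \sum_(i <- s) F i * G i.
  by apply: sumr_ge0 => i _; rewrite mulr_ge0 ?rnorm_ge0.
have FG : \sum_(i <- s) F i * G i <= p * q.
  rewrite -ler_sqr ?nnegrE ?mulr_ge0// exprMn.
  apply: le_trans (CauchySchwarz_sum _ _ _) _.
  by apply: ler_pM => //; apply: sumr_ge0 => i _; exact: sqr_ge0.
apply: (@le_trans _ _ (\sum_(i <- s) (F i + G i) ^+ 2)).
  apply: ler_sum => i _.
  by rewrite ler_sqr ?nnegrE ?addr_ge0 ?rnorm_ge0 ?rnormD.
under eq_bigr do rewrite sqrrD.
rewrite !big_split /= sqrrD mulr2n.
by rewrite !lerD.
Qed.

End RealNorm.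

(** * The space l_2 as a complete normed space *)

Section Ell2Normed.
Variable R : realType.
Implicit Types a b : ell2 R.

Lemma ell2_sum_leP (u : nat -> R[i]^o) (M : R) :
  (ell2_sum u <= M%:E)%E <-> forall N, \sum_(0 <= n < N) sqn (u n) <= M.
Proof.
split=> [le_uM N|le_uM].
  rewrite -lee_fin -sumEFin; apply: le_trans le_uM.
  by apply: nneseries_lim_ge => n _ _; exact: ell2_term_ge0.
apply: lime_le; first by apply: is_cvg_nneseries => n _ _; exact: ell2_term_ge0.
by apply: nearW => N; rewrite sumEFin lee_fin.
Qed.

Lemma ell2_sum_ge0 (u : nat -> R[i]^o) : (0 <= ell2_sum u)%E.
Proof. by apply: nneseries_ge0 => n _ _; exact: ell2_term_ge0. Qed.

Lemma ell2_bounded (u : nat -> R[i]) (M : R) :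
  (forall N, \sum_(0 <= n < N) sqn (u n) <= M) -> u \in @ell2_pred R.
Proof. by move=> /ell2_sum_leP uM; apply/asboolP/(le_lt_trans uM)/ltry. Qed.

Lemma finsupp_sum_le (u : nat -> R[i]) m N :
  (forall n, (m <= n)%N -> u n = 0) ->
  \sum_(0 <= n < N) sqn (u n) <= \sum_(0 <= n < m) sqn (u n).
Proof.
move=> u0; have [Nm|mN] := leqP N m.
  rewrite [leRHS](@big_cat_nat _ _ _ N)//= lerDl.
  by apply: sumr_ge0 => n _; exact: sqn_ge0.
rewrite (@big_cat_nat _ _ _ m)//= ?(ltnW mN)//.
rewrite [X in _ + X]big_nat_cond [X in _ + X]big1 ?addr0// => n /andP[/andP[mn _] _].
by rewrite u0// sqn0.
Qed.

(** The squared norm is the working quantity: it adds up over orthogonal pieces, and bounding it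
    amounts to bounding all partial sums. *)
Definition nsq a : R := fine (ell2_sum a).

Lemma nsqE a : ell2_sum a = (nsq a)%:E.
Proof.
rewrite fineK// ge0_fin_numE ?ell2_sum_ge0//.
by case: a => u u2; exact/asboolP/u2.
Qed.

Lemma nsq_ge0 a : 0 <= nsq a. Proof. by rewrite fine_ge0 ?ell2_sum_ge0. Qed.

Lemma nsq_leP a M :
  nsq a <= M <-> forall N, \sum_(0 <= n < N) sqn (a n) <= M.
Proof. by rewrite -lee_fin -nsqE; exact: ell2_sum_leP. Qed.

Lemma nsq_ge a N : \sum_(0 <= n < N) sqn (a n) <= nsq a.
Proof. by move: N; apply/nsq_leP. Qed.

Lemma nsq_term a n : sqn (a n) <= nsq a.
Proof.
apply: le_trans (nsq_ge a n.+1); rewrite big_nat_recr//= lerDr.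
by apply: sumr_ge0 => i _; exact: sqn_ge0.
Qed.

Lemma nsq_finsupp a m : (forall n, (m <= n)%N -> a n = 0) ->
  nsq a = \sum_(0 <= n < m) sqn (a n).
Proof.
move=> a0; apply/eqP; rewrite eq_le nsq_ge andbT.
by apply/nsq_leP => N; exact: finsupp_sum_le.
Qed.

Lemma nsq_cvg a : \sum_(0 <= k < n) sqn (a k) @[n --> \oo] --> nsq a.
Proof.
have : (\sum_(0 <= k < n) sqn (a k))%:E @[n --> \oo] --> (nsq a)%:E.
  rewrite -nsqE; under eq_fun do rewrite -sumEFin.
  by apply: is_cvg_nneseries => n _ _; exact: ell2_term_ge0.
by move=> /fine_cvgP[].
Qed.

Lemma ell2_norm_ge0 a : 0 <= ell2_norm a. Proof. exact: sqrtr_ge0. Qed.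

Lemma ell2_norm_sq a : ell2_norm a ^+ 2 = nsq a.
Proof. by rewrite sqr_sqrtr ?nsq_ge0. Qed.

Lemma ell2_normD a b : ell2_norm (a + b) <= ell2_norm a + ell2_norm b.
Proof.
rewrite -ler_sqr ?nnegrE ?addr_ge0 ?ell2_norm_ge0// ell2_norm_sq.
apply/nsq_leP => N; apply: Minkowski_sum; rewrite ?ell2_norm_ge0//.
  by rewrite ell2_norm_sq nsq_ge.
by rewrite ell2_norm_sq nsq_ge.
Qed.

Lemma nsqZ (c : R[i]) a : nsq (c *: a) = sqn c * nsq a.
Proof.
apply: (cvgn_unique (@nsq_cvg (c *: a))).
rewrite [X in X @ _](_ : _ = fun n => sqn c * \sum_(0 <= k < n) sqn (a k)).
  by apply: cvgMl_tmp; exact: nsq_cvg.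
by apply/funext => n; rewrite mulr_sumr; apply: eq_bigr => k _; rewrite -sqnM.
Qed.

Lemma ell2_normZ (c : R[i]) a : ell2_norm (c *: a) = rnorm (c : R[i]^o) * ell2_norm a.
Proof.
apply/eqP; rewrite -(@eqrXn2 _ 2) ?mulr_ge0 ?rnorm_ge0 ?ell2_norm_ge0//.
by rewrite exprMn !ell2_norm_sq nsqZ.
Qed.

Lemma ell2_norm_eq0 a : ell2_norm a = 0 -> a = 0.
Proof.
move=> a0; have {}a0 : nsq a = 0 by rewrite -ell2_norm_sq a0 expr0n.
apply/val_inj/funext => n /=.
have : sqn (a n) <= 0 by rewrite -a0 nsq_term.
rewrite le_eqVlt ltNge sqn_ge0 orbF /sqn sqrf_eq0 => /eqP an0.
by apply/eqP; rewrite -normr_eq0 -rnorm_normE an0.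
Qed.

Definition ell2_cnorm a : R[i] := (ell2_norm a)%:C.

Lemma ell2_cnormD a b : ell2_cnorm (a + b) <= ell2_cnorm a + ell2_cnorm b.
Proof. by rewrite -rmorphD lecR ell2_normD. Qed.

Lemma ell2_cnormZ (c : R[i]) a : ell2_cnorm (c *: a) = `|c| * ell2_cnorm a.
Proof. by rewrite /ell2_cnorm ell2_normZ rmorphM /= rnorm_normE. Qed.

Lemma ell2_cnorm_eq0 a : ell2_cnorm a = 0 -> a = 0.
Proof. by move=> /complexI/ell2_norm_eq0. Qed.

HB.instance Definition _ := Lmodule_isNormed.Build R[i] (ell2 R)
  ell2_cnormD ell2_cnormZ ell2_cnorm_eq0.

Lemma rnorm_sq a : rnorm a ^+ 2 = nsq a. Proof. exact: ell2_norm_sq. Qed.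

(** Here [p] stands for the real or the imaginary part. Each coordinate is dominated by the norm, so
    a Cauchy filter has Cauchy images in [R], which is complete. *)
Lemma cauchy_coord (F : set_system (ell2 R)) (FF : ProperFilter F)
    (p : R[i] -> R) (n : nat) :
  (forall z w, p (z - w) = p z - p w) ->
  (forall z, `|p z| <= rnorm (z : R[i]^o)) ->
  cauchy F -> cvg ((fun x : ell2 R => p (x n)) @ F).
Proof.
move=> pB p_le /rnorm_cauchy Fc.
apply: cauchy_cvg; apply/cauchy_ballP => e e0.
rewrite near_map2.
apply: filterS (Fc _ e0) => -[x y] /= xye.
rewrite -ball_normE /ball_ /= -pB; apply: le_lt_trans (p_le _) _.
apply: le_lt_trans xye.
rewrite -ler_sqr ?nnegrE ?rnorm_ge0// rnorm_sq.
exact: (nsq_term (x - y)).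
Qed.

Lemma ell2_complete (F : set_system (ell2 R)) : ProperFilter F ->
  cauchy F -> cvg F.
Proof.
move=> FF Fc.
have reF n : cvg ((fun x : ell2 R => complex.Re (x n)) @ F).
  by apply: cauchy_coord => // [[? ?] [? ?]//|]; exact: Re_le_rnorm.
have imF n : cvg ((fun x : ell2 R => complex.Im (x n)) @ F).
  by apply: cauchy_coord => // [[? ?] [? ?]//|]; exact: Im_le_rnorm.
pose l n : R[i]^o :=
  lim ((fun x : ell2 R => complex.Re (x n)) @ F) +i*
  lim ((fun x : ell2 R => complex.Im (x n)) @ F).
(* For fixed [x] and [N], the limit along [y] is taken in a finite sum, where coordinatewise
   convergence suffices. The resulting bound does not depend on [N]. *)
have Fl r : 0 < r -> \forall x \near F,
    forall N, \sum_(0 <= n < N) sqn ((x : ell2 R) n - l n) <= r ^+ 2.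
  move=> r0; have /(nearP_dep (F := F)(G := F)) := rnorm_cauchy FF Fc r0.
  apply: filterS => x xF N.
  apply: (@cvgr_to_le _ F _ _ (fun y : ell2 R => \sum_(0 <= n < N) sqn (x n - y n))).
    apply: cvg_big => [|n _]; first exact: add_continuous.
    rewrite sqnE; under eq_fun do rewrite sqnE.
    have re : complex.Re (x n - (y : ell2 R) n) @[y --> F] -->
              complex.Re (x n - l n).
      rewrite raddfB /=; under eq_fun do rewrite raddfB /=.
      by apply: cvgB; [exact: cvg_cst|exact: reF].
    have im : complex.Im (x n - (y : ell2 R) n) @[y --> F] -->
              complex.Im (x n - l n).
      rewrite raddfB /=; under eq_fun do rewrite raddfB /=.
      by apply: cvgB; [exact: cvg_cst|exact: imF].
    under eq_fun do rewrite !expr2.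
    by rewrite !expr2; apply: cvgD; exact: cvgM.
  apply: filterS xF => y /ltW xyr; apply: le_trans (nsq_ge (x - y) N) _.
  by rewrite -rnorm_sq ler_sqr ?nnegrE ?rnorm_ge0 ?(ltW r0).
have l2 : l \in @ell2_pred R.
  have /filter_ex[x xl] := Fl 1 ltr01.
  have xl2 := ell2_bounded xl.
  (* The coordinatewise limit is square summable as a difference of two square summable
     sequences. *)
  have -> : l = ell2_val x - (fun n => x n - l n).
    by apply/funext => n; rewrite !fctE opprB addrC subrK.
  by apply: rpredB => //; exact: valP.
apply/cvg_ex; exists (Ell2 l2).
apply/rnorm_cvgP => r r0.
(* [Fl] gives a non-strict bound; halving the radius makes it strict. *)
have r20 : 0 < r / 2 by rewrite divr_gt0.
apply: filterS (Fl _ r20) => x xl.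
have /le_lt_trans : rnorm (Ell2 l2 - x) <= r / 2; last first.
  by apply; rewrite ltr_pdivrMr// ltr_pMr// ltr1n.
rewrite -ler_sqr ?nnegrE ?rnorm_ge0 ?(ltW r20)// rnorm_sq.
apply/nsq_leP => N; apply: le_trans (xl N).
by apply: ler_sum => n _; rewrite -sqn_opp opprB.
Qed.

HB.instance Definition _ := Uniform_isComplete.Build (ell2 R) ell2_complete.

End Ell2Normed.

(** * The bilinear pairing and the Hilbert space structure of l_2 *)

Section Pairing.
Variable R : realType.
Implicit Types (c : R[i]) (a b h y : ell2 R).

Lemma is_cvg_summable (u : nat -> R) (M : R) :
  (forall N, \sum_(0 <= n < N) `|u n| <= M) ->
  cvgn (fun N => \sum_(0 <= n < N) u n).
Proof.
move=> uM; apply: (@normed_cvg R R u).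
apply: nondecreasing_is_cvgn; last first.
  by exists M => _ [N _ <-]; exact: uM.
exact: nondecreasing_series (fun n _ _ => normr_ge0 (u n)).
Qed.

(** No conjugation: the row operators must be linear both in the element of the operator space and
    in the Hilbert space vector. The inner product [ell2_dot] arises by conjugating the second
    argument. *)
Definition pairing y h : R[i] :=
  limn (fun N => \sum_(0 <= n < N) y n * h n : R[i]^o).

Lemma pairing_cvg y h :
  (\sum_(0 <= n < N) y n * h n : R[i]^o) @[N --> \oo] --> (pairing y h : R[i]^o).
Proof.
suff H (p : {additive R[i] -> R}) :
    (forall z, `|p z| <= rnorm (z : R[i]^o)) ->
    cvgn (fun N => p (\sum_(0 <= n < N) y n * h n)).
  have /cvg_ex[s sP] := H (@complex.Re R) (@Re_le_rnorm R).
  have /cvg_ex[t tP] := H (@complex.Im R) (@Im_le_rnorm R).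
  by apply/cvg_ex; exists (s +i* t); exact: cvg_complex.
move=> p_le; under eq_fun do rewrite raddf_sum.
(* The series converges absolutely, because the modulus of a product is at most the sum of the
   squared moduli. *)
apply: (@is_cvg_summable _ (nsq y + nsq h)) => N.
apply: le_trans (lerD (nsq_ge y N) (nsq_ge h N)).
rewrite -big_split /=; apply: ler_sum => n _.
apply: le_trans (p_le _) _; rewrite rnormZ /sqn.
have := sqr_ge0 (rnorm (y n) - rnorm (h n)); rewrite sqrrB.
have := mulr_ge0 (rnorm_ge0 (y n)) (rnorm_ge0 (h n)); lra.
Qed.

Lemma pairingC y h : pairing y h = pairing h y.
Proof.
rewrite /pairing; under eq_fun do under eq_bigr do rewrite mulrC.
by [].
Qed.

Lemma pairing_linear h : linear (pairing ^~ h : ell2 R -> R[i]^o).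
Proof.
move=> c y y'; apply: (cvgn_unique (@pairing_cvg (c *: y + y') h)).
rewrite [X in X @ _](_ : _ = fun N => c *: (\sum_(0 <= n < N) y n * h n : R[i]^o)
  + (\sum_(0 <= n < N) y' n * h n : R[i]^o)).
  by apply: cvgD; [apply: cvgZl_tmp|]; exact: pairing_cvg.
apply/funext => N; rewrite scaler_sumr -big_split; apply: eq_bigr => n _.
by rewrite /= mulrDl -scalerAl.
Qed.

Lemma rnorm_lim_le (V : normedModType R[i]) (u : nat -> V) (l : V) (B : R) :
  u n @[n --> \oo] --> l -> (forall n, rnorm (u n) <= B) -> rnorm l <= B.
Proof.
move=> /rnorm_cvgP ul uB; apply/ler_addgt0Pl => e e0.
have /filter_ex[n un] := ul _ e0.
by rewrite -(subrK (u n) l); apply: le_trans (rnormD _ _) (lerD (ltW un) _).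
Qed.

Lemma pairing_le y h : sqn (pairing y h) <= nsq y * nsq h.
Proof.
have p0 : 0 <= nsq y * nsq h by rewrite mulr_ge0 ?nsq_ge0.
rewrite -[leRHS]sqr_sqrtr// ler_sqr ?nnegrE ?rnorm_ge0 ?sqrtr_ge0//.
apply: rnorm_lim_le (@pairing_cvg y h) _ => N.
rewrite -ler_sqr ?nnegrE ?rnorm_ge0 ?sqrtr_ge0// sqr_sqrtr//.
apply: le_trans (CauchySchwarz_csum _ _ _) _.
apply: ler_pM; rewrite ?nsq_ge//; by apply: sumr_ge0 => n _; exact: sqn_ge0.
Qed.

Fact econj_subproof a : (fun n => (a n)^*) \in @ell2_pred R.
Proof.
apply: (@ell2_bounded _ _ (nsq a)) => N; under eq_bigr do rewrite sqn_conj.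
exact: nsq_ge.
Qed.

Definition econj a : ell2 R := Ell2 (econj_subproof a).

Lemma econjK : involutive econj.
Proof. by move=> a; apply/val_inj/funext => n; rewrite /= conjcK. Qed.

Lemma econjP c a b : econj (c *: a + b) = c^* *: econj a + econj b.
Proof. by apply/val_inj/funext => n; rewrite /= rmorphD rmorphM. Qed.

Lemma nsq_econj a : nsq (econj a) = nsq a.
Proof.
apply: (cvgn_unique (@nsq_cvg _ (econj a))).
under eq_fun do under eq_bigr do rewrite /= sqn_conj.
exact: nsq_cvg.
Qed.

Lemma pairing_econj a b : pairing (econj a) (econj b) = (pairing a b)^*.
Proof.
apply: (cvgn_unique (@pairing_cvg (econj a) (econj b))).
apply/rnorm_cvgP => r r0; have /rnorm_cvgP/(_ _ r0) := @pairing_cvg a b.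
apply: filterS => N; congr (_ < _).
rewrite -[LHS]rnorm_conj; congr rnorm.
rewrite rmorphB rmorph_sum /=; congr (_ - _).
by apply: eq_bigr => n _; rewrite rmorphM.
Qed.

Lemma pairing_nsq a : pairing a (econj a) = (nsq a)%:C.
Proof.
apply: (cvgn_unique (@pairing_cvg a (econj a))).
under eq_fun do under eq_bigr do rewrite /= mulcJ.
under eq_fun do rewrite -rmorph_sum.
by apply: cvg_complex; [exact: nsq_cvg|exact: cvg_cst].
Qed.

Definition ell2_dot a b : R[i] := pairing a (econj b).

Lemma ell2_dot_linearl b :
  GRing.linear_for *%R (ell2_dot ^~ b : ell2 R -> R[i]).
Proof. exact: pairing_linear. Qed.

Lemma ell2_dot_linearr a :
  GRing.linear_for (Num.conj \; *%R : R[i] -> R[i] -> R[i]) (ell2_dot a : ell2 R -> R[i]).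
Proof.
by move=> c b b'; rewrite /ell2_dot econjP pairingC pairing_linear -!(pairingC a).
Qed.

HB.instance Definition _ := bilinear_isBilinear.Build R[i] (ell2 R) (ell2 R) R[i]
  *%R (Num.conj \; *%R) ell2_dot (ell2_dot_linearl, ell2_dot_linearr).

Lemma ell2_dot_hermitian a b :
  ell2_dot a b = (-1) ^+ false * Num.conj (ell2_dot b a).
Proof.
by rewrite expr0 mul1r -[RHS]pairing_econj econjK pairingC.
Qed.

HB.instance Definition _ := isHermitianSesquilinear.Build R[i] (ell2 R) false
  Num.conj ell2_dot ell2_dot_hermitian.

Lemma ell2_dot_gt0 a : a != 0 -> 0 < ell2_dot a a.
Proof.
move=> a0; rewrite /ell2_dot pairing_nsq ltcR lt_neqAle nsq_ge0 andbT eq_sym.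
apply: contra a0 => /eqP a0.
by apply/eqP/ell2_norm_eq0; rewrite /ell2_norm -/(nsq a) a0 sqrtr0.
Qed.

HB.instance Definition _ := isDotProduct.Build R[i] (ell2 R) ell2_dot ell2_dot_gt0.

Lemma ell2_dotE a : `|a| ^+ 2 = ell2_dot a a.
Proof. by rewrite /ell2_dot pairing_nsq -rnorm_normE -rmorphXn rnorm_sq. Qed.

Definition ell2_hilbert : hilbertSpace R := HilbertSpace ell2_dotE.

End Pairing.

(** * Orthogonal splittings of l_2: even and odd coordinates, first coordinate and tail *)

Section Ell2Shape.
Variable R : realType.
Implicit Types (c : R[i]) (a b h y : ell2 R).

Lemma big_nat_double (F : nat -> R) N :
  \sum_(0 <= n < 2 * N) F n =
  \sum_(0 <= n < N) F (2 * n)%N + \sum_(0 <= n < N) F (2 * n).+1.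
Proof.
elim: N => [|N IH]; first by rewrite muln0 !big_nil addr0.
by rewrite mulnS !big_nat_recr//= IH -addrA addrACA.
Qed.

Fact evens_subproof a : (fun n => a (2 * n)%N) \in @ell2_pred R.
Proof.
apply: (@ell2_bounded _ _ (nsq a)) => N; apply: le_trans (nsq_ge a (2 * N)).
by rewrite big_nat_double lerDl; apply: sumr_ge0 => n _; exact: sqn_ge0.
Qed.
Definition evens a : ell2 R := Ell2 (evens_subproof a).

Fact odds_subproof a : (fun n => a (2 * n).+1) \in @ell2_pred R.
Proof.
apply: (@ell2_bounded _ _ (nsq a)) => N; apply: le_trans (nsq_ge a (2 * N)).
by rewrite big_nat_double lerDr; apply: sumr_ge0 => n _; exact: sqn_ge0.
Qed.
Definition odds a : ell2 R := Ell2 (odds_subproof a).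

Lemma nsq_evens_odds a : nsq a = nsq (evens a) + nsq (odds a).
Proof.
have ndouble : (2 * n)%N @[n --> \oo] --> \oo by exact: cvg_mulnl.
apply: (@cvgn_unique _ _ (fun N => \sum_(0 <= n < 2 * N) sqn (a n)) (nsq a)).
  exact: (cvg_comp _ _ ndouble (@nsq_cvg _ a)).
under eq_fun do rewrite big_nat_double.
by apply: cvgD; [exact: (@nsq_cvg _ (evens a))|exact: (@nsq_cvg _ (odds a))].
Qed.

Fact einter_subproof a b :
  (fun n => if odd n then b n./2 else a n./2) \in @ell2_pred R.
Proof.
apply: (@ell2_bounded _ _ (nsq a + nsq b)) => N.
(* The range is enlarged to even length so that it splits into even and odd indices. *)
apply: (@le_trans _ _ (\sum_(0 <= n < 2 * N)
    sqn (if odd n then b n./2 else a n./2))).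
  rewrite (@big_cat_nat _ _ _ N 0%N (2 * N)) ?leq_pmull//= lerDl.
  by apply: sumr_ge0 => n _; exact: sqn_ge0.
rewrite big_nat_double; apply: lerD.
  under eq_bigr do rewrite mul2n odd_double doubleK; exact: nsq_ge.
under eq_bigr do rewrite mul2n oddS odd_double /= uphalf_double; exact: nsq_ge.
Qed.
Definition einter a b : ell2 R := Ell2 (einter_subproof a b).

Lemma evens_einter a b : evens (einter a b) = a.
Proof.
by apply/val_inj/funext => n /=; rewrite mul2n odd_double doubleK.
Qed.

Lemma odds_einter a b : odds (einter a b) = b.
Proof.
by apply/val_inj/funext => n /=; rewrite mul2n odd_double uphalf_double.
Qed.

Lemma nsq_einter a b : nsq (einter a b) = nsq a + nsq b.
Proof. by rewrite nsq_evens_odds evens_einter odds_einter. Qed.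

Fact econs_subproof c a :
  (fun n => if n is m.+1 then a m else c) \in @ell2_pred R.
Proof.
apply: (@ell2_bounded _ _ (sqn c + nsq a)) => -[|N].
  by rewrite big_nil addr_ge0 ?sqn_ge0 ?nsq_ge0.
by rewrite big_nat_recl// lerD2l nsq_ge.
Qed.
Definition econs c a : ell2 R := Ell2 (econs_subproof c a).

Fact behead_subproof a : (fun n => a n.+1) \in @ell2_pred R.
Proof.
apply: (@ell2_bounded _ _ (nsq a)) => N; apply: le_trans (nsq_ge a N.+1).
by rewrite big_nat_recl// lerDr sqn_ge0.
Qed.
Definition ebehead a : ell2 R := Ell2 (behead_subproof a).

Lemma ebehead_econs c a : ebehead (econs c a) = a.
Proof. exact/val_inj/funext. Qed.

Lemma nsq_behead a : nsq a = sqn (a 0%N) + nsq (ebehead a).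
Proof.
apply: (@cvgn_unique _ _ (fun N => \sum_(0 <= n < N.+1) sqn (a n)) (nsq a)).
  by rewrite (cvg_shiftS (fun N => \sum_(0 <= n < N) sqn (a n))); exact: nsq_cvg.
under eq_fun do rewrite big_nat_recl//.
by apply: cvgD; [exact: cvg_cst|exact: (@nsq_cvg _ (ebehead a))].
Qed.

Lemma nsq_econs c a : nsq (econs c a) = sqn c + nsq a.
Proof. by rewrite nsq_behead ebehead_econs. Qed.

Lemma evens_is_linear : linear evens.
Proof. by move=> c a b; exact/val_inj/funext. Qed.
HB.instance Definition _ := GRing.isLinear.Build R[i] (ell2 R) (ell2 R) _ evens
  evens_is_linear.

Lemma odds_is_linear : linear odds.
Proof. by move=> c a b; exact/val_inj/funext. Qed.
HB.instance Definition _ := GRing.isLinear.Build R[i] (ell2 R) (ell2 R) _ odds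
  odds_is_linear.

Lemma ebehead_is_linear : linear ebehead.
Proof. by move=> c a b; exact/val_inj/funext. Qed.
HB.instance Definition _ := GRing.isLinear.Build R[i] (ell2 R) (ell2 R) _ ebehead
  ebehead_is_linear.

Lemma econsP c (z w : R[i]) a b :
  c *: econs z a + econs w b = econs (c * z + w) (c *: a + b).
Proof. by apply/val_inj/funext => -[]. Qed.

Lemma einterP c a b a' b' :
  c *: einter a b + einter a' b' = einter (c *: a + a') (c *: b + b').
Proof. by apply/val_inj/funext => n /=; rewrite !fctE; case: ifP. Qed.

Lemma econs_sum I (s : seq I) (z : I -> R[i]) (v : I -> ell2 R) :
  \sum_(i <- s) econs (z i) (v i) = econs (\sum_(i <- s) z i) (\sum_(i <- s) v i).
Proof.
elim/big_rec3: _ => [|i u w _ _ ->]; first by apply/val_inj/funext => -[].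
by rewrite -[econs (z i) _]scale1r econsP mul1r scale1r.
Qed.

Lemma nsq_sum_le I (s : seq I) (z : I -> R[i]) (v : I -> ell2 R) :
  nsq (\sum_(i <- s) z i *: v i) <=
  (\sum_(i <- s) sqn (z i)) * (\sum_(i <- s) nsq (v i)).
Proof.
under [X in _ * X]eq_bigr do rewrite -rnorm_sq.
apply: le_trans (CauchySchwarz_sum _ _ _).
rewrite -rnorm_sq ler_sqr ?nnegrE ?rnorm_ge0 ?sumr_ge0//; last first.
  by move=> i _; rewrite mulr_ge0 ?rnorm_ge0.
by apply: le_trans (rnorm_sum _ _) _; apply: ler_sum => i _; rewrite rnormZ.
Qed.

(** Cauchy-Schwarz enters twice: inside each pairing, and for the list of norms left by the triangle
    inequality. *)
Lemma sqn_sum_pairing_le I (s : seq I) (y h : I -> ell2 R) :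
  sqn (\sum_(i <- s) pairing (y i) (h i)) <=
  (\sum_(i <- s) nsq (y i)) * (\sum_(i <- s) nsq (h i)).
Proof.
under [X in X * _]eq_bigr do rewrite -rnorm_sq.
under [X in _ * X]eq_bigr do rewrite -rnorm_sq.
apply: le_trans (CauchySchwarz_sum _ _ _).
rewrite ler_sqr ?nnegrE ?rnorm_ge0 ?sumr_ge0//; last first.
  by move=> i _; rewrite mulr_ge0 ?rnorm_ge0.
apply: le_trans (rnorm_sum _ _) _; apply: ler_sum => i _.
rewrite -ler_sqr ?nnegrE ?mulr_ge0 ?rnorm_ge0// exprMn !rnorm_sq.
exact: pairing_le.
Qed.

End Ell2Shape.

(** * Operator spaces on l_2 with one column and two row structures *)

Section RowColSpace.
Variable R : realType.
Variables T1 T2 : {linear ell2 R -> ell2 R}.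
Hypothesis T1_le : forall x, nsq (T1 x) <= nsq x.
Hypothesis T2_le : forall x, nsq (T2 x) <= nsq x.
Local Notation H := (ell2_hilbert R).

(* The coordinate 0, the odd and the positive even coordinates of [h] are the
   domains of one column operator and two row operators with pairwise orthogonal
   ranges: the matrix norm is the maximum of the three. *)
Definition rc_op (x : ell2 R) (h : H) : H :=
  econs (pairing (T1 x) (evens (ebehead h)))
    (econs (pairing (T2 x) (odds (ebehead h))) ((h : ell2 R) 0%N *: x)).

Lemma rc_op_is_linear x : linear (rc_op x).
Proof.
move=> c h k; rewrite /rc_op !linearP /= !econsP scalerA scalerDl.
by rewrite !(pairingC (T1 x)) !(pairingC (T2 x)) !pairing_linear.
Qed.

HB.instance Definition _ x := GRing.isLinear.Build R[i] H H _ (rc_op x)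
  (@rc_op_is_linear x).

Lemma nsq_split3 (h : ell2 R) :
  nsq h = sqn (h 0%N) + (nsq (evens (ebehead h)) + nsq (odds (ebehead h))).
Proof. by rewrite nsq_behead (nsq_evens_odds (ebehead h)). Qed.

(** Each of the three output components depends on its own piece of [h] in [nsq_split3], and [T1],
    [T2] are contractions. The three estimates add up with the common factor [nsq x]. *)
Lemma rc_op_le x (h : ell2 R) : nsq (rc_op x h) <= nsq x * nsq h.
Proof.
rewrite !nsq_econs nsqZ (nsq_split3 h) !mulrDr [leRHS]addrC -addrA [sqn _ * _]mulrC.
apply: lerD.
  apply: le_trans (pairing_le _ _) _.
  by rewrite ler_wpM2r ?nsq_ge0.
rewrite lerD2r; apply: le_trans (pairing_le _ _) _.
by rewrite ler_wpM2r ?nsq_ge0.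
Qed.

Lemma rc_op_rnorm_le x (h : ell2 R) : rnorm (rc_op x h) <= rnorm x * rnorm h.
Proof.
rewrite -ler_sqr ?nnegrE ?mulr_ge0 ?rnorm_ge0// exprMn.
by rewrite !rnorm_sq; exact: rc_op_le.
Qed.

Lemma rc_op_continuous x : continuous (rc_op x).
Proof.
move=> h; apply/(rnorm_cvgP (nbhs_filter h)) => r r0.
have x1 : 0 < rnorm x + 1 by rewrite ltr_pwDr ?rnorm_ge0.
have /(rnorm_cvgP (nbhs_filter h))/(_ (r / (rnorm x + 1))) :
  k @[k --> h] --> h by exact: cvg_id.
rewrite divr_gt0// => /(_ isT); apply: filterS => k hk.
rewrite -linearB; apply: le_lt_trans (rc_op_rnorm_le _ _) _.
move: hk; rewrite ltr_pdivlMr//; apply: le_lt_trans.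
by rewrite mulrC ler_wpM2l ?rnorm_ge0// lerDl.
Qed.

Lemma rc_op_linear_l (c : R[i]) x y (h : H) :
  rc_op (c *: x + y) h = c *: rc_op x h + rc_op y h.
Proof.
by rewrite /rc_op !linearP /= !econsP !pairing_linear.
Qed.

(** The upper bound is contractivity of the three pieces; it is attained at the unit vector
    [econs 1 0], where the column component returns [x] itself. *)
Lemma rc_op_isometry x :
  rnorm x = sup [set rnorm (rc_op x h) | h in [set h : H | rnorm h <= 1]].
Proof.
have ub : ubound [set rnorm (rc_op x h) | h in [set h : H | rnorm h <= 1]] (rnorm x).
  move=> _ [h h1 <-]; apply: le_trans (rc_op_rnorm_le _ _) _.
  by rewrite ler_piMr ?rnorm_ge0.
have e1 : rnorm (econs 1 0 : ell2 R) <= 1.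
  rewrite -ler_sqr ?nnegrE ?rnorm_ge0// rnorm_sq nsq_econs sqnE /=.
  by rewrite -rnorm_sq rnorm0 expr0n !expr1n addr0 addr0.
apply/eqP; rewrite eq_le; apply/andP; split; last first.
  by apply: ge_sup => //; exists (rnorm (rc_op x (econs 1 0))), (econs 1 0).
apply: (@le_trans _ _ (rnorm (rc_op x (econs 1 0)))).
  rewrite -ler_sqr ?nnegrE ?rnorm_ge0// !rnorm_sq !nsq_econs /= scale1r.
  by rewrite addrA lerDr addr_ge0 ?sqn_ge0.
apply: sup_upper_bound; last by exists (econs 1 0).
by split; [exists (rnorm (rc_op x (econs 1 0))), (econs 1 0)|exists (rnorm x)].
Qed.

Definition rcSpace : opSpace R :=
  OpSpace rc_op_continuous rc_op_linear_l rc_op_isometry.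

(** The column structure: [x] acts as an operator from C^k to the sum of k copies of l_2, and [t]
    bounds its squared norm. *)
Definition col_bound k (x : 'M[ell2 R]_k) (t : R) := forall c : 'I_k -> R[i],
  \sum_i nsq (\sum_j c j *: x i j) <= t * \sum_j sqn (c j).

(** The row structure seen through [T]: the entries become functionals, so the matrix acts from the
    sum of k copies of l_2 to C^k. *)
Definition row_bound (T : ell2 R -> ell2 R) k (x : 'M[ell2 R]_k) (t : R) :=
  forall h : 'I_k -> ell2 R,
  \sum_i sqn (\sum_j pairing (T (x i j)) (h j)) <= t * \sum_j nsq (h j).

Definition ampl_bound k (x : 'M[rcSpace]_k) (t : R) := forall h : 'cV[H]_k,
  \sum_i nsq (os_ampl x h i 0) <= t * \sum_j nsq (h j 0).

Lemma hsum_norm_sq k (h : 'cV[H]_k) : hsum_norm h ^+ 2 = \sum_i nsq (h i 0).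
Proof.
rewrite sqr_sqrtr; last by apply: sumr_ge0 => i _; exact: sqr_ge0.
by apply: eq_bigr => i _; rewrite rnorm_sq.
Qed.

Lemma hsum_norm_ge0 k (h : 'cV[H]_k) : 0 <= hsum_norm h.
Proof. exact: sqrtr_ge0. Qed.

Lemma os_amplE k (x : 'M[rcSpace]_k) (h : 'cV[H]_k) i : os_ampl x h i 0 =
  econs (\sum_j pairing (T1 (x i j)) (evens (ebehead (h j 0))))
   (econs (\sum_j pairing (T2 (x i j)) (odds (ebehead (h j 0))))
     (\sum_j (h j 0 : ell2 R) 0%N *: (x i j : ell2 R))).
Proof. by rewrite mxE !econs_sum. Qed.

(** The amplification is an orthogonal direct sum of one column and two row operators. Vectors
    supported in a single domain isolate each bound; conversely the three bounds add up because both
    domains and ranges are orthogonal. *)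
Lemma ampl_boundP k (x : 'M[rcSpace]_k) t : 0 <= t ->
  ampl_bound x t <-> [/\ col_bound x t, row_bound T1 x t & row_bound T2 x t].
Proof.
move=> t0; split=> [xt|[xC x1 x2] h].
  have amplE (h : 'I_k -> ell2 R) :
      \sum_i nsq (os_ampl x (\col_j h j) i 0) =
      \sum_i sqn (\sum_j pairing (T1 (x i j)) (evens (ebehead (h j)))) +
      (\sum_i sqn (\sum_j pairing (T2 (x i j)) (odds (ebehead (h j)))) +
       \sum_i nsq (\sum_j h j 0%N *: (x i j : ell2 R))).
    rewrite -!big_split; apply: eq_bigr => i _; rewrite os_amplE !nsq_econs.
    by congr (sqn _ + (sqn _ + nsq _)); apply: eq_bigr => j _; rewrite mxE.
  have sqn_sum_ge0 (F : 'I_k -> R[i]) : 0 <= \sum_i sqn (F i).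
    by apply: sumr_ge0 => i _; exact: sqn_ge0.
  have nsq_sum_ge0 (F : 'I_k -> ell2 R) : 0 <= \sum_i nsq (F i).
    by apply: sumr_ge0 => i _; exact: nsq_ge0.
  have nsq0 : nsq (0 : ell2 R) = 0 by rewrite -rnorm_sq rnorm0 expr0n.
  split=> [c|h|h].
  - have := xt (\col_j econs (c j) 0); rewrite amplE.
    under [X in _ * X]eq_bigr do rewrite mxE nsq_econs nsq0 addr0.
    by apply: le_trans; rewrite addrA lerDr addr_ge0.
  - have := xt (\col_j econs 0 (einter (h j) 0)); rewrite amplE.
    under [X in _ * X]eq_bigr do
      rewrite mxE nsq_econs nsq_einter nsq0 sqn0 add0r addr0.
    under [X in X + _ <= _]eq_bigr do under eq_bigr do
      rewrite ebehead_econs evens_einter.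
    by apply: le_trans; rewrite lerDl addr_ge0.
  - have := xt (\col_j econs 0 (einter 0 (h j))); rewrite amplE.
    under [X in _ * X]eq_bigr do
      rewrite mxE nsq_econs nsq_einter nsq0 sqn0 !add0r.
    under [X in _ + (X + _) <= _]eq_bigr do under eq_bigr do
      rewrite ebehead_econs odds_einter.
    by apply: le_trans; rewrite addrCA lerDl addr_ge0.
under eq_bigr do rewrite os_amplE !nsq_econs.
rewrite !big_split /=.
under [X in _ * X]eq_bigr do rewrite nsq_split3.
rewrite !big_split /= !mulrDr [leRHS]addrC -[leRHS]addrA.
by rewrite !lerD.
Qed.

(** A Hilbert-Schmidt bound. It shows that the set in [os_norm] is bounded, without which its [sup]
    would be a default value. *)
Lemma ampl_bound_exists k (x : 'M[rcSpace]_k) : exists2 M, 0 <= M & ampl_bound x M.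
Proof.
pose M := \sum_i \sum_j nsq (x i j : ell2 R).
have M0 : 0 <= M by do 2!apply: sumr_ge0 => ? _; exact: nsq_ge0.
exists M => //; apply/ampl_boundP => //; split=> [c|h|h].
- rewrite mulr_suml; apply: ler_sum => i _; rewrite mulrC; exact: nsq_sum_le.
- rewrite mulr_suml; apply: ler_sum => i _.
  apply: le_trans (sqn_sum_pairing_le _ _ _) _.
  rewrite ler_wpM2r ?ler_sum//; by apply: sumr_ge0 => j _; exact: nsq_ge0.
- rewrite mulr_suml; apply: ler_sum => i _.
  apply: le_trans (sqn_sum_pairing_le _ _ _) _.
  rewrite ler_wpM2r ?ler_sum//; by apply: sumr_ge0 => j _; exact: nsq_ge0.
Qed.

Lemma os_amplZ k (x : 'M[rcSpace]_k) (c : R[i]) (h : 'cV[H]_k) i :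
  os_ampl x (\col_j (c *: h j 0)) i 0 = c *: os_ampl x h i 0.
Proof.
by rewrite !mxE scaler_sumr; apply: eq_bigr => j _; rewrite mxE linearZ.
Qed.

Lemma os_norm_has_sup k (x : 'M[rcSpace]_k) :
  has_sup [set hsum_norm (os_ampl x h) | h in [set h | hsum_norm h <= 1]].
Proof.
have [M M0 xM] := ampl_bound_exists x; split.
  exists (hsum_norm (os_ampl x (0 : 'cV[H]_k))), (0 : 'cV[H]_k) => //=.
  by rewrite /hsum_norm big1 ?sqrtr0// => i _; rewrite mxE rnorm0 expr0n.
exists (Num.sqrt M) => _ [h /= h1 <-].
rewrite -ler_sqr ?nnegrE ?hsum_norm_ge0 ?sqrtr_ge0// hsum_norm_sq sqr_sqrtr//.
apply: le_trans (xM h) _; rewrite -hsum_norm_sq ler_piMr//.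
by rewrite expr_le1 ?hsum_norm_ge0.
Qed.

Lemma os_norm_ge0 k (x : 'M[rcSpace]_k) : 0 <= os_norm x.
Proof.
have [[s [h h1 hs]] ub] := os_norm_has_sup x.
apply: (@le_trans _ _ s); first by rewrite -hs; exact: hsum_norm_ge0.
by apply: sup_upper_bound; [exact: os_norm_has_sup|exists h].
Qed.

Lemma os_norm_amplP k (x : 'M[rcSpace]_k) t : 0 <= t ->
  os_norm x <= t <-> ampl_bound x (t ^+ 2).
Proof.
move=> t0; have xsup := os_norm_has_sup x.
split=> [xt h|xt]; last first.
  apply: ge_sup; first by case: xsup.
  move=> _ [h /= h1 <-].
  rewrite -ler_sqr ?nnegrE ?hsum_norm_ge0// hsum_norm_sq.
  apply: le_trans (xt h) _; rewrite -hsum_norm_sq ler_piMr ?sqr_ge0//.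
  by rewrite expr_le1 ?hsum_norm_ge0.
have [M M0 xM] := ampl_bound_exists x.
(* A vector of norm zero cannot be normalised; there the crude bound [M] already forces the image to
   vanish. *)
have := hsum_norm_ge0 h; rewrite le_eqVlt => /predU1P[h0|h0].
  have := xM h; rewrite -[X in _ * X]hsum_norm_sq -h0 expr0n mulr0 => /le_trans; apply.
  by rewrite -hsum_norm_sq mulr_ge0 ?sqr_ge0.
pose c : R[i] := (hsum_norm h)^-1%:C.
have sc : sqn c = (hsum_norm h ^+ 2)^-1 by rewrite sqn_real exprVn.
have ch1 : hsum_norm (\col_j (c *: h j 0)) <= 1.
  rewrite -ler_sqr ?nnegrE ?hsum_norm_ge0// hsum_norm_sq.
  under eq_bigr do rewrite mxE nsqZ.
  rewrite -mulr_sumr -hsum_norm_sq sc mulVf ?expr1n//.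
  by rewrite sqrf_eq0 gt_eqF.
have : hsum_norm (os_ampl x (\col_j (c *: h j 0))) <= t.
  by apply: le_trans xt; apply: sup_upper_bound => //; exists (\col_j (c *: h j 0)).
rewrite -ler_sqr ?nnegrE ?hsum_norm_ge0// hsum_norm_sq.
under eq_bigr do rewrite os_amplZ nsqZ.
by rewrite -mulr_sumr sc mulrC ler_pdivrMr ?exprn_gt0// -hsum_norm_sq.
Qed.

Lemma os_norm_leP k (x : 'M[rcSpace]_k) t : 0 <= t ->
  os_norm x <= t <->
  [/\ col_bound x (t ^+ 2), row_bound T1 x (t ^+ 2) & row_bound T2 x (t ^+ 2)].
Proof.
move=> t0; rewrite -(ampl_boundP _ (sqr_ge0 t)); exact: os_norm_amplP.
Qed.

End RowColSpace.

(** * Separability of l_2 by finite sequences of Gaussian rationals *)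

Section Separable.
Variable R : realType.

Definition gauss (q : rat * rat) : R[i] := ratr q.1 +i* ratr q.2.

Fact finseq_subproof (s : seq (rat * rat)) :
  (fun n => gauss (nth (0, 0) s n)) \in @ell2_pred R.
Proof.
apply: ell2_bounded => N; apply: (@finsupp_sum_le _ _ (size s)) => n sn.
by rewrite nth_default// /gauss /= !rmorph0.
Qed.

Definition finseq s : ell2 R := Ell2 (finseq_subproof s).

Lemma gauss_dense (z : R[i]) (e : R) : 0 < e -> exists q, sqn (z - gauss q) <= e.
Proof.
move=> e0; pose d := Num.sqrt (e / 2).
have d0 : 0 < d by rewrite sqrtr_gt0 divr_gt0.
have approx (r : R) : exists q, (r - ratr q) ^+ 2 <= e / 2.
  have : r - d < r + d by rewrite ltrD2l; lra.
  move=> /rat_in_itvoo[q]; rewrite in_itv /= => /andP[q1 q2].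
  exists q; rewrite -[leRHS]sqr_sqrtr ?divr_ge0 ?(ltW e0)//.
  rewrite -/d -(real_normK (num_real _)) ler_sqr ?nnegrE ?(ltW d0)//.
  by rewrite ler_norml; apply/andP; split; lra.
case: z => a b; have [p ap] := approx a; have [q bq] := approx b.
exists (p, q); rewrite sqnE /= [leRHS]splitr.
exact: lerD.
Qed.

Lemma ell2_separable : separable (ell2 R).
Proof.
exists (range finseq).
  by apply: (sub_countable (card_image_le _ _)); exact: countableP.
move=> O [x Ox] oO.
have : nbhs x O by apply: open_nbhs_nbhs.
move=> /nbhs_ballP[_ /= /complex_gt0[r r0 ->] xrO].
suff [s xs] : exists s, rnorm (x - finseq s) < r.
  exists (finseq s); split; last by exists s.
  by apply: xrO; rewrite -ball_normE /ball_ /= -rnorm_normE ltcR.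
(* The first [N] coordinates and the tail each contribute at most [e], and [e + e] is half of
   [r ^+ 2]. *)
pose e := r ^+ 2 / 4; have e0 : 0 < e by rewrite divr_gt0 ?exprn_gt0.
have /cvgrPdist_lt/(_ _ e0)/filter_ex[N] := @nsq_cvg _ x.
rewrite ger0_norm ?subr_ge0 ?nsq_ge// => xN.
(* The error [e] is shared among [N] coordinates; the successor avoids division by zero when [N] is
   0. *)
have eN : 0 < e / N.+1%:R by rewrite divr_gt0.
have /choice[q qP] n := gauss_dense (x n) eN.
exists (mkseq q N).
have x_s : nsq (x - finseq (mkseq q N)) <= e + e.
  apply/nsq_leP => M.
  apply: (@le_trans _ _ (\sum_(0 <= n < N + M)
      sqn ((x - finseq (mkseq q N)) n))).
    rewrite [leRHS](@big_cat_nat _ _ _ M) ?leq_addl//= lerDl.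
    by apply: sumr_ge0 => n _; exact: sqn_ge0.
  rewrite (@big_cat_nat _ _ _ N) ?leq_addr//=; apply: lerD.
    apply: (@le_trans _ _ (\sum_(0 <= n < N) (e / N.+1%:R))).
      apply: ler_sum_nat => n /andP[_ nN].
      by rewrite !fctE /= nth_mkseq.
    rewrite sumr_const_nat subn0 -[leLHS]mulr_natr -mulrA ler_piMr ?(ltW e0)//.
    by rewrite ler_pdivrMl// mulr1 ler_nat.
  apply: le_trans (ltW xN); rewrite lerBrDl.
  apply: le_trans (nsq_ge x (N + M)).
  rewrite [leRHS](@big_cat_nat _ _ _ N) ?leq_addr//= lerD2l.
  apply: ler_sum_nat => n /andP[Nn _].
  by rewrite !fctE /= nth_default ?size_mkseq// /gauss /= rmorph0 subr0.
rewrite -ltr_sqr ?nnegrE ?rnorm_ge0 ?(ltW r0)// rnorm_sq.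
apply: le_lt_trans x_s _; rewrite /e; have := exprn_gt0 2 r0; lra.
Qed.

End Separable.

(** * The spaces X and Y and the complete isometry into c_0(Y) *)

Section Spaces.
Variable R : realType.
Variable a : nat -> R.
Hypothesis a01 : forall n, 0 <= a n <= 1.
Implicit Types x y : ell2 R.

Fact wmul_subproof x : (fun n => (a n)%:C * x n) \in @ell2_pred R.
Proof.
apply: (@ell2_bounded _ _ (nsq x)) => N; apply: le_trans (nsq_ge x N).
apply: ler_sum => n _; rewrite sqnM sqn_real ler_piMl ?sqn_ge0//.
by have /andP[an0 an1] := a01 n; rewrite expr_le1.
Qed.
Definition wmul x : ell2 R := Ell2 (wmul_subproof x).

Lemma nsq_wmul_le x : nsq (wmul x) <= nsq x.
Proof.
apply/nsq_leP => N; apply: le_trans (nsq_ge x N).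
apply: ler_sum => n _; rewrite sqnM sqn_real ler_piMl ?sqn_ge0//.
by have /andP[an0 an1] := a01 n; rewrite expr_le1.
Qed.

Definition wevens x := wmul (evens x).
Definition wodds x := wmul (odds x).

Lemma wmulP (c : R[i]) x y : wmul (c *: x + y) = c *: wmul x + wmul y.
Proof.
by apply/val_inj/funext => n /=; rewrite !fctE /= mulrDr /GRing.scale /= mulrCA.
Qed.

Lemma wevens_is_linear : linear wevens.
Proof. by move=> c x y; rewrite /wevens linearP wmulP. Qed.
HB.instance Definition _ := GRing.isLinear.Build R[i] (ell2 R) (ell2 R) _ wevens
  wevens_is_linear.

Lemma wodds_is_linear : linear wodds.
Proof. by move=> c x y; rewrite /wodds linearP wmulP. Qed.
HB.instance Definition _ := GRing.isLinear.Build R[i] (ell2 R) (ell2 R) _ wodds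
  wodds_is_linear.

Lemma wevens_le x : nsq (wevens x) <= nsq x.
Proof.
by rewrite (le_trans (nsq_wmul_le _))// (nsq_evens_odds x) lerDl nsq_ge0.
Qed.

Lemma wodds_le x : nsq (wodds x) <= nsq x.
Proof.
by rewrite (le_trans (nsq_wmul_le _))// (nsq_evens_odds x) lerDr nsq_ge0.
Qed.

(** With [wevens] in both row slots the matrix norm carries one weighted row norm; [spaceX] has a
    second one, on the odd coordinates. *)
Definition spaceY : opSpace R := rcSpace wevens_le wevens_le.
Definition spaceX : opSpace R := rcSpace wevens_le wodds_le.

Definition eswap x : ell2 R := einter (odds x) (evens x).

Lemma eswap_is_linear : linear eswap.
Proof. by move=> c x y; rewrite /eswap !linearP einterP. Qed.
HB.instance Definition _ := GRing.isLinear.Build R[i] (ell2 R) (ell2 R) _ eswap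
  eswap_is_linear.

Lemma nsq_eswap x : nsq (eswap x) = nsq x.
Proof. by rewrite nsq_einter addrC -nsq_evens_odds. Qed.

Lemma wevens_eswap x : wevens (eswap x) = wodds x.
Proof. by rewrite /wevens evens_einter. Qed.

Definition c0_seq x (n : nat) : spaceY :=
  match n with 0 => x | 1 => eswap x | _ => 0 end.

Fact c0_seq_subproof x : c0_seq x \in @c0_pred R spaceY.
Proof.
apply/asboolP; apply: cvg_near_cst; exists 2%N => // n /=.
by case: n => [|[|n]].
Qed.
Definition c0_embed (x : spaceX) : c0 spaceY := C0 (c0_seq_subproof x).

Lemma c0_embed_is_linear : linear c0_embed.
Proof.
move=> c x y; apply/val_inj/funext => -[|[|n]] //=; rewrite !fctE /=.
  exact: eswap_is_linear.
by rewrite scaler0 addr0.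
Qed.
HB.instance Definition _ := GRing.isLinear.Build R[i] spaceX (c0 spaceY) _
  c0_embed c0_embed_is_linear.

Lemma col_bound_eswap k (x : 'M[ell2 R]_k) t :
  col_bound (map_mx eswap x) t <-> col_bound x t.
Proof.
suff eq_sum c : \sum_i nsq (\sum_j c j *: map_mx eswap x i j) =
    \sum_i nsq (\sum_j c j *: x i j).
  by split=> xt c; move: (xt c); congr (_ <= _); [|symmetry]; exact: eq_sum.
apply: eq_bigr => i _; rewrite -[RHS]nsq_eswap linear_sum; congr nsq.
by apply: eq_bigr => j _; rewrite mxE linearZ.
Qed.

Lemma row_bound_eswap k (x : 'M[ell2 R]_k) t :
  row_bound wevens (map_mx eswap x) t <-> row_bound wodds x t.
Proof.
suff eq_sum h : \sum_i sqn (\sum_j pairing (wevens (map_mx eswap x i j)) (h j)) =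
    \sum_i sqn (\sum_j pairing (wodds (x i j)) (h j)).
  by split=> xt h; move: (xt h); congr (_ <= _); [|symmetry]; exact: eq_sum.
apply: eq_bigr => i _; congr sqn; apply: eq_bigr => j _.
by rewrite mxE wevens_eswap.
Qed.

(** The swap [eswap] is a Hilbert space isometry, so it preserves the column norm, and it turns the
    even row norm into the odd one. Hence the norm of X is the maximum of two norms of Y. *)
Lemma os_normX_leP k (x : 'M[spaceX]_k) t : 0 <= t ->
  os_norm x <= t <->
  @os_norm R spaceY k x <= t /\ @os_norm R spaceY k (map_mx eswap x) <= t.
Proof.
move=> t0.
split=> [/(os_norm_leP _ t0)[xC x1 x2]|[/(os_norm_leP _ t0)[xC x1 _]]].
  split; apply/(os_norm_leP _ t0); split=> //; first exact/col_bound_eswap.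
    exact/row_bound_eswap.
  exact/row_bound_eswap.
move=> /(os_norm_leP _ t0)[_ /row_bound_eswap x2 _].
by apply/(os_norm_leP _ t0).
Qed.

Lemma c0_embed_isometry :
  complete_isometry (@os_norm R spaceX) (@c0_norm R spaceY) c0_embed.
Proof.
move=> k x.
have evE n : map_mx (fun y : c0 spaceY => y n) (map_mx c0_embed x) =
    match n with 0 => x | 1 => map_mx eswap x | _ => 0 end.
  by apply/matrixP => i j; rewrite !mxE; case: n => [|[|n]] //=; rewrite mxE.
have x0 := os_norm_ge0 x.
have [xY sxY] := (os_normX_leP x x0).1 (lexx _).
(* Boundedness gives one inequality directly. It also makes the supremum genuine, so that terms 0
   and 1 lie below it and give the other inequality; all further terms are zero matrices. *)
have ub : ubound (range (fun n => os_norm (map_mx (fun y : c0 spaceY => y n)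
    (map_mx c0_embed x)))) (os_norm x).
  move=> _ [n _ <-]; rewrite evE.
  case: n => [|[|n]]; [exact: xY|exact: sxY|].
  apply/(os_norm_leP _ x0).
  have bound0 T (T0 : T 0 = 0) : row_bound T (0 : 'M[ell2 R]_k) (os_norm x ^+ 2).
    move=> h; rewrite big1 => [|i' _].
      by rewrite mulr_ge0 ?sqr_ge0// sumr_ge0// => j _; exact: nsq_ge0.
    apply/eqP; rewrite eq_le sqn_ge0 andbT; apply: le_trans (sqn_sum_pairing_le _ _ _) _.
    by rewrite big1 ?mul0r// => j _; rewrite mxE T0 -rnorm_sq rnorm0 expr0n.
  split; [|exact/bound0/linear0..] => c.
  rewrite big1 => [|i' _]; last first.
    by rewrite big1 => [|j _]; rewrite ?mxE ?scaler0// -rnorm_sq rnorm0 expr0n.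
  by rewrite mulr_ge0 ?sqr_ge0// sumr_ge0// => j _; exact: sqn_ge0.
apply/eqP; rewrite eq_le; apply/andP; split.
  apply: ge_sup => //.
  by exists (os_norm (map_mx (fun y : c0 spaceY => y 0%N) (map_mx c0_embed x))), 0%N.
have hs : has_sup (range (fun n => os_norm (map_mx (fun y : c0 spaceY => y n)
    (map_mx c0_embed x)))).
  split; last by exists (os_norm x).
  by exists (os_norm (map_mx (fun y : c0 spaceY => y 0%N) (map_mx c0_embed x))), 0%N.
have le_sup n : os_norm (map_mx (fun y : c0 spaceY => y n) (map_mx c0_embed x))
    <= c0_norm (map_mx c0_embed x).
  by apply: (sup_upper_bound hs); exists n.
have := le_sup 0%N; have := le_sup 1%N; rewrite !evE => le1 le0.
apply/os_normX_leP; last by split; [exact: le0|exact: le1].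
exact: le_trans (os_norm_ge0 _) le0.
Qed.

(** The Banach space underlying [rcSpace] is l_2 with its own norm, so the identity serves as the
    isomorphism. *)
Lemma rc_hilbertian (T1 T2 : {linear ell2 R -> ell2 R})
  (h1 : forall x, nsq (T1 x) <= nsq x)
  (h2 : forall x, nsq (T2 x) <= nsq x) : hilbertian (@rcSpace R T1 T2 h1 h2).
Proof.
exists (idfun : {linear ell2 R -> ell2 R}); split.
- by exists id.
- by exists 1 => x; rewrite mul1r.
- by exists 1 => x; rewrite mul1r.
Qed.

End Spaces.

(** * Finitely supported vectors and orthonormal systems *)

Section FiniteSupport.
Variable R : realType.
Local Open Scope sesquilinear_scope.

Definition efin_fun m (u : 'rV[R[i]]_m) (n : nat) : R[i] :=
  if insub n is Some i then u 0 i else 0.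

Lemma efin_fun_ge m (u : 'rV[R[i]]_m) n : (m <= n)%N -> efin_fun u n = 0.
Proof. by move=> mn; rewrite /efin_fun insubN// -leqNgt. Qed.

Fact efin_subproof m (u : 'rV[R[i]]_m) : efin_fun u \in @ell2_pred R.
Proof.
apply: ell2_bounded => N; apply: (@finsupp_sum_le _ _ m) => n.
exact: efin_fun_ge.
Qed.

Definition efin m (u : 'rV[R[i]]_m) : ell2 R := Ell2 (efin_subproof u).

Lemma efin_is_linear m : linear (@efin m).
Proof.
move=> c u v; apply/val_inj/funext => n; rewrite /= !fctE /efin_fun /=.
by case: insub => [i|]; rewrite ?mxE// scaler0 addr0.
Qed.
HB.instance Definition _ m := GRing.isLinear.Build R[i] 'rV[R[i]]_m (ell2 R) _
  (@efin m) (@efin_is_linear m).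

Lemma nsq_efin m (u : 'rV[R[i]]_m) : nsq (efin u) = \sum_i sqn (u 0 i).
Proof.
rewrite (@nsq_finsupp _ _ m); last by move=> n; exact: efin_fun_ge.
by rewrite big_mkord; apply: eq_bigr => i _; rewrite /= /efin_fun valK.
Qed.

(** For a rectangular [V], [unitarymx] says that the rows are orthonormal: combining them with
    coefficients [c] preserves the squared norm of [c]. *)
Lemma sum_sqn_unitary m n (V : 'M[R[i]]_(m, n)) (c : 'rV[R[i]]_m) :
  V \is unitarymx -> \sum_i sqn ((c *m V) 0 i) = \sum_i sqn (c 0 i).
Proof.
move=> /unitarymxP VV.
have sqnE k (w : 'rV[R[i]]_k) :
    (\sum_i sqn (w 0 i))%:C = (w *m w ^t Num.conj) 0 0.
  by rewrite rmorph_sum mxE; apply: eq_bigr => i _; rewrite !mxE /= -mulcJ.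
apply: complexI; rewrite !sqnE; congr (fun_of_matrix _ 0 0).
by rewrite trmx_mul map_mxM mulmxA -(mulmxA c) VV mulmx1.
Qed.

End FiniteSupport.

(** * The obstruction to a complete isomorphic embedding of X into Y *)

Section NotEmbeds.
Variable R : realType.
Variable a : nat -> R.
Hypothesis a01 : forall n, 0 <= a n <= 1.
Local Notation X := (spaceX a01).
Local Notation Y := (spaceY a01).

Lemma nsq_wmul_ge (x : ell2 R) S (alpha : R) : 0 <= alpha ->
  (forall n, (n < S)%N -> alpha <= a n) -> (forall n, (S <= n)%N -> x n = 0) ->
  alpha ^+ 2 * nsq x <= nsq (wmul a01 x).
Proof.
move=> alpha0 a_ge x0; rewrite -(sqn_real alpha) -nsqZ.
apply/nsq_leP => N; apply: le_trans (nsq_ge _ N); apply: ler_sum => n _.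
rewrite /= !fctE /= !sqnM !sqn_real.
have [nS|Sn] := ltnP n S; last by rewrite x0// sqn0 !mulr0.
rewrite ler_wpM2r ?sqn_ge0// ler_sqr ?nnegrE ?a_ge//.
by have /andP[] := a01 n.
Qed.

Lemma nsq_wmul_tail (x : ell2 R) S (beta : R) : 0 <= beta ->
  (forall n, (S <= n)%N -> a n <= beta) -> (forall n, (n < S)%N -> x n = 0) ->
  nsq (wmul a01 x) <= beta ^+ 2 * nsq x.
Proof.
move=> beta0 a_le x0; rewrite -(sqn_real beta) -nsqZ.
apply/nsq_leP => N; apply: le_trans (nsq_ge _ N); apply: ler_sum => n _.
rewrite /= !fctE /= !sqnM !sqn_real.
have [nS|Sn] := ltnP n S; first by rewrite x0// sqn0 !mulr0.
rewrite ler_wpM2r ?sqn_ge0// ler_sqr ?nnegrE ?a_le//.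
by have /andP[] := a01 n.
Qed.

(** The column part alone, tested at the scalar 1, already gives the norm of [v]. *)
Lemma rnorm_le_os_norm (T1 T2 : {linear ell2 R -> ell2 R})
  (h1 : forall x, nsq (T1 x) <= nsq x)
  (h2 : forall x, nsq (T2 x) <= nsq x) (v : ell2 R) :
  rnorm v <= @os_norm R (@rcSpace R T1 T2 h1 h2) 1 (const_mx v).
Proof.
have os0 := os_norm_ge0 (const_mx v : 'M[@rcSpace R T1 T2 h1 h2]_1).
have /(os_norm_leP _ os0)[/(_ (fun=> 1))] :=
  lexx (os_norm (const_mx v : 'M[@rcSpace R T1 T2 h1 h2]_1)).
rewrite !big_ord1 mxE scale1r (sqn_real 1) expr1n mulr1 -rnorm_sq.
by rewrite ler_sqr ?nnegrE ?rnorm_ge0.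
Qed.

Lemma os_norm_le_rnorm (T1 T2 : {linear ell2 R -> ell2 R})
  (h1 : forall x, nsq (T1 x) <= nsq x)
  (h2 : forall x, nsq (T2 x) <= nsq x) (v : ell2 R) :
  @os_norm R (@rcSpace R T1 T2 h1 h2) 1 (const_mx v) <= rnorm v.
Proof.
apply/os_norm_leP; first exact: rnorm_ge0.
rewrite rnorm_sq; split=> [c|h|h]; rewrite !big_ord1 mxE.
- by rewrite nsqZ mulrC.
- by apply: le_trans (pairing_le _ _) _; rewrite ler_wpM2r ?nsq_ge0.
- by apply: le_trans (pairing_le _ _) _; rewrite ler_wpM2r ?nsq_ge0.
Qed.

(** Rank-nullity for the left kernel of [B], followed by Gram-Schmidt on a basis of it. *)
Lemma kernel_unitary m n (B : 'M[R[i]]_(m, n)) : exists r (V : 'M[R[i]]_(r, m)),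
  [/\ (m - n <= r)%N, V \is unitarymx & V *m B = 0].
Proof.
exists (\rank (kermx B)), (schmidt (row_base (kermx B))).
have rm : (\rank (kermx B) <= m)%N by exact: rank_leq_row.
split; first by rewrite mxrank_ker leq_sub2l// rank_leq_col.
  exact: schmidt_unitarymx.
by apply/sub_kermxP; rewrite eqmx_schmidt_free ?row_base_free// eq_row_base.
Qed.

Lemma cb_nsq_le (f : {linear X -> Y}) (K : R) (v : ell2 R) :
  (forall k (x : 'M[X]_k), @os_norm R Y k (map_mx f x) <= K * @os_norm R X k x) ->
  nsq (f v) <= (K ^+ 2 : R) * nsq v.
Proof.
move=> f_cb; have := f_cb 1%N (const_mx v); rewrite map_const_mx => fv.
(* The sign of [K] is not given, hence the absolute value. *)
have le_fv : rnorm (f v) <= `|K| * rnorm v.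
  apply: le_trans (rnorm_le_os_norm (wevens_le a01) (wevens_le a01) (f v)) _.
  apply: le_trans fv _.
  apply: (@le_trans _ _ (`|K| * @os_norm R X 1 (const_mx v))).
    by apply: ler_wpM2r (ler_norm K); exact: os_norm_ge0.
  by apply: ler_wpM2l => //; exact: os_norm_le_rnorm.
rewrite -!rnorm_sq -(real_normK (num_real K)) -exprMn.
by rewrite ler_sqr ?nnegrE ?mulr_ge0 ?rnorm_ge0.
Qed.

(** The quantitative core: a row of [r] orthonormal vectors is measured in X from below through
    [alpha], and its image in Y from above through [beta]. The two constants of the embedding link
    the estimates. *)
Lemma no_embedding (f : {linear X -> Y}) (K K' : R) (S : nat) (alpha beta : R) :
  (forall k (x : 'M[X]_k), @os_norm R Y k (map_mx f x) <= K * @os_norm R X k x) ->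
  (forall k (x : 'M[X]_k), @os_norm R X k x <= K' * @os_norm R Y k (map_mx f x)) ->
  0 <= alpha -> 0 <= beta ->
  (forall n, (n < S)%N -> alpha <= a n) -> (forall n, (S <= n)%N -> a n <= beta) ->
  exists2 r, (S <= r)%N &
    alpha ^+ 2 * r%:R ^+ 2 <= 2 * (K' ^+ 2 * (K ^+ 2 * r%:R * (1 + beta ^+ 2 * r%:R))).
Proof.
move=> f_cb g_cb alpha0 beta0 a_ge a_le.
pose fe (u : 'rV[R[i]]_(2 * S)) : ell2 R := f (efin u).
have fe_linear : linear fe by move=> c u v; rewrite /fe !linearP.
(* The vanishing of [G] is [S] linear equations on a space of dimension [2 * S], so its kernel has
   dimension [r] at least [S]. The rows of [V] will be an orthonormal basis of it. *)
pose G (u : 'rV[R[i]]_(2 * S)) : 'rV[R[i]]_S := \row_(j < S) fe u (2 * j)%N.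
have G_linear : linear G.
  by move=> c u v; apply/rowP => j; rewrite !mxE fe_linear.
pose GL : {linear 'rV[R[i]]_(2 * S) -> 'rV[R[i]]_S} :=
  HB.pack G (GRing.isLinear.Build _ _ _ _ G G_linear).
have [r [V [Sr Vu VG]]] := kernel_unitary (lin1_mx GL).
exists r; first by apply: leq_trans Sr; rewrite mul2n -addnn addnK.
pose v (l : 'I_r) : ell2 R := efin (row l V).
have sumv (c : 'I_r -> R[i]) : \sum_l c l *: v l = efin ((\row_l c l) *m V).
  rewrite mulmx_sum_row linear_sum; apply: eq_bigr => l _.
  by rewrite linearZ mxE.
have nsq_sumv (c : 'I_r -> R[i]) : nsq (\sum_l c l *: v l) = \sum_l sqn (c l).
  rewrite sumv nsq_efin sum_sqn_unitary//.
  by apply: eq_bigr => l _; rewrite mxE.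
have nsq_v l : nsq (v l) = 1.
  rewrite nsq_efin rowE sum_sqn_unitary// (bigD1 l)//= big1 ?addr0 => [|l' l'l].
    by rewrite mxE !eqxx sqn_real expr1n.
  by rewrite mxE eqxx (negbTE l'l) sqn0.
have v_supp l n : (2 * S <= n)%N -> v l n = 0 by exact: efin_fun_ge.
have fv0 l n : (n < S)%N -> f (v l) (2 * n)%N = 0.
  move=> nS; have : GL (row l V) = 0.
    by rewrite -mul_rV_lin1 -row_mul VG row0.
  by move=> /rowP/(_ (Ordinal nS)); rewrite !mxE.
(* Matrix norms are taken on square matrices, so the row of the [v j] is repeated [r] times. This
   multiplies every squared column or row norm by [r]. *)
pose x : 'M[ell2 R]_r := \matrix_(i, j) v j.
(* The conjugates of the [T (v j)] are the extremal test vectors: with [q] the sum of the squared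
   norms, the bound reads [r%:R * q ^+ 2 <= t * q], and [q] is cancelled when nonzero. *)
have test (T : ell2 R -> ell2 R) (t : R) : 0 <= t -> row_bound T x t ->
    r%:R * (\sum_j nsq (T (v j))) <= t.
  set q := \sum_j _ => t0 /(_ (fun j => econj (T (v j)))).
  have q0 : 0 <= q by apply: sumr_ge0 => j _; exact: nsq_ge0.
  rewrite (eq_bigr (fun=> q ^+ 2)) => [|i _].
    rewrite [X in _ * X](eq_bigr (fun j => nsq (T (v j)))) => [|j _]; last first.
      exact: nsq_econj.
    rewrite sumr_const card_ord -[leLHS]mulr_natl -/q expr2 mulrA => le_tq.
    have [->|q_neq0] := eqVneq q 0; first by rewrite mulr0.
    by rewrite -(ler_pM2r (x := q)) ?lt_neqAle ?q0 1?eq_sym ?q_neq0.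
  rewrite -sqn_real; congr sqn; rewrite rmorph_sum; apply: eq_bigr => j _.
  by rewrite mxE pairing_nsq.
have lower : alpha ^+ 2 * r%:R ^+ 2 <= 2 * @os_norm R X r x ^+ 2.
  have x0 : 0 <= @os_norm R X r x by exact: os_norm_ge0.
  have /(os_norm_leP _ x0)[_ /(test _ _ (sqr_ge0 _)) x1 /(test _ _ (sqr_ge0 _)) x2] :=
    lexx (@os_norm R X r x).
  (* Each [v l] is a unit vector in the first [2 * S] coordinates, so its even and odd parts live on
     indices below [S], where the weights are at least [alpha]. The X-norm bounds both row norms,
     whence the factor 2 in [lower]. *)
  have : alpha ^+ 2 * r%:R <=
      \sum_j nsq (wevens a01 (v j)) + \sum_j nsq (wodds a01 (v j)).
    rewrite -big_split /= -[r in r%:R]card_ord -sum1_card natr_sum mulr_sumr.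
    apply: ler_sum => l _; rewrite -(nsq_v l) (nsq_evens_odds (v l)) mulrDr.
    by apply: lerD; apply: (nsq_wmul_ge alpha0 a_ge) => n Sn; apply: v_supp;
      rewrite ?leqW// leq_mul2l Sn.
  move=> /(ler_wpM2l (ler0n R r)); rewrite mulrDr => /le_trans le2.
  rewrite expr2 mulrCA mulr_natl mulr2n; apply: (le_trans _ (lerD x1 x2)).
  by apply: le2.
(* The summand 1 accounts for the column part, which is controlled by boundedness of [f] at level 1.
   The summand with [beta] accounts for the row part: [fv0] leaves only weights of index at least
   [S]. The sum dominates the maximum. *)
have upper : @os_norm R Y r (map_mx f x) ^+ 2 <=
    K ^+ 2 * r%:R * (1 + beta ^+ 2 * r%:R).
  set s2 := K ^+ 2 * _ * _.
  have K2r0 : 0 <= K ^+ 2 * r%:R by exact: mulr_ge0 (sqr_ge0 _) (ler0n _ _).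
  have beta2r0 : 0 <= beta ^+ 2 * r%:R by exact: mulr_ge0 (sqr_ge0 _) (ler0n _ _).
  have s20 : 0 <= s2 by apply: mulr_ge0 => //; exact: addr_ge0.
  have [s s0 ss] : exists2 s, 0 <= s & s ^+ 2 = s2.
    by exists (Num.sqrt s2); rewrite ?sqrtr_ge0 ?sqr_sqrtr.
  rewrite -ss ler_sqr ?nnegrE//; last exact: os_norm_ge0.
  have fx_row : row_bound (wevens a01) (map_mx f x) s2.
    move=> h; apply: (@le_trans _ _ (\sum_(i < r)
        (r%:R * (beta ^+ 2 * K ^+ 2)) * \sum_j nsq (h j))).
      apply: ler_sum => i _; apply: le_trans (sqn_sum_pairing_le _ _ _) _.
      apply: ler_wpM2r; first by apply: sumr_ge0 => j _; exact: nsq_ge0.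
      rewrite -[r in r%:R]card_ord -sum1_card natr_sum mulr_suml.
      apply: ler_sum => j _; rewrite mul1r !mxE.
      apply: (@le_trans _ _ (beta ^+ 2 * nsq (evens (f (v j))))).
        by apply: (nsq_wmul_tail beta0 a_le) => n nS; exact: fv0.
      rewrite ler_wpM2l ?sqr_ge0//.
      apply: (@le_trans _ _ (nsq (f (v j)))).
        by rewrite (nsq_evens_odds (f (v j))) lerDl nsq_ge0.
      by rewrite -[leRHS]mulr1 -(nsq_v j); exact: cb_nsq_le.
    rewrite sumr_const card_ord -[leLHS]mulr_natl mulrA.
    apply: ler_wpM2r; first by apply: sumr_ge0 => j _; exact: nsq_ge0.
    rewrite [leLHS](_ : _ = K ^+ 2 * r%:R * (beta ^+ 2 * r%:R)); last by ring.
    by apply: ler_wpM2l => //; rewrite lerDr.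
  apply/(os_norm_leP _ s0); rewrite ss; split=> // c.
  apply: (@le_trans _ _ (\sum_(i < r) K ^+ 2 * \sum_j sqn (c j))).
    apply: ler_sum => i _; rewrite -nsq_sumv.
    have -> : \sum_j c j *: map_mx f x i j = f (\sum_j c j *: v j).
      by rewrite linear_sum; apply: eq_bigr => j _; rewrite !mxE linearZ.
    exact: cb_nsq_le.
  rewrite sumr_const card_ord -[leLHS]mulr_natl mulrA.
  apply: ler_wpM2r; first by apply: sumr_ge0 => j _; exact: sqn_ge0.
  by rewrite mulrC -[leLHS]mulr1; apply: ler_wpM2l => //; rewrite lerDl.
apply: le_trans lower _; rewrite ler_wpM2l//.
have x0 : 0 <= @os_norm R X r x by exact: os_norm_ge0.
apply: (@le_trans _ _ ((K' * @os_norm R Y r (map_mx f x)) ^+ 2)).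
  by rewrite ler_sqr ?nnegrE ?(le_trans x0).
by rewrite exprMn ler_wpM2l ?sqr_ge0.
Qed.

End NotEmbeds.

(** * Block weights and the numerical gap at block ends *)

Lemma fact_leq m n : (m <= n)%N -> (m`! <= n`!)%N.
Proof.
elim: n => [|n IH]; first by rewrite leqn0 => /eqP->.
rewrite leq_eqVlt => /predU1P[->//|/IH/leq_trans]; apply.
by rewrite factS leq_pmull.
Qed.

Lemma level_exists n : exists k, (n < k`! ^ 3)%N.
Proof.
exists n.+1; apply: (@leq_trans n.+1`!).
  by rewrite factS leq_pmulr ?fact_gt0.
by rewrite -[leqLHS]expn1 leq_pexp2l ?fact_gt0.
Qed.

Definition level n : nat := ex_minn (level_exists n).

Lemma level_le n k : (n < k`! ^ 3)%N -> (level n <= k)%N.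
Proof. by rewrite /level; case: ex_minnP => m _ m_min; exact: m_min. Qed.

Lemma level_gt n k : (k`! ^ 3 <= n)%N -> (k < level n)%N.
Proof.
rewrite /level; case: ex_minnP => m nm _ kn; rewrite ltnNge; apply/negP => mk.
have : (m`! ^ 3 <= n)%N.
  by apply: leq_trans kn; rewrite leq_exp2r// fact_leq.
by rewrite leqNgt nm.
Qed.

Section Weight.
Variable R : realType.

(* Constant on long blocks, with ratio tending to infinity between consecutive
   blocks, and tending to 0 so slowly that [weight n ^+ 2 * n] still tends to
   infinity along the ends of the blocks. *)
Definition weight (n : nat) : R := ((level n)`!%:R)^-1.

Lemma weight01 n : 0 <= weight n <= 1.
Proof.
by rewrite invr_ge0 ler0n invf_le1 ?ler1n ?ltr0n fact_gt0.
Qed.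

Lemma weight_ge n k : (n < k`! ^ 3)%N -> (k`!%:R)^-1 <= weight n.
Proof.
move=> /level_le nk; rewrite lef_pV2 ?posrE ?ltr0n ?fact_gt0//.
by rewrite ler_nat fact_leq.
Qed.

Lemma weight_le n k : (k`! ^ 3 <= n)%N -> weight n <= (k.+1`!%:R)^-1.
Proof.
move=> /level_gt nk; rewrite lef_pV2 ?posrE ?ltr0n ?fact_gt0//.
by rewrite ler_nat fact_leq.
Qed.

Lemma weight_gap (L : R) (k r : nat) : 0 <= L -> 4 * L < k%:R ->
  (k`! ^ 3 <= r)%N ->
  2 * (L * r%:R * (1 + (k.+1`!%:R)^-1 ^+ 2 * r%:R)) <
  (k`!%:R)^-1 ^+ 2 * r%:R ^+ 2.
Proof.
move=> L0 Lk Sr.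
have k0 : 0 < k%:R :> R by apply: le_lt_trans Lk; rewrite mulr_ge0.
have F0 : 0 < k`!%:R :> R by rewrite ltr0n fact_gt0.
have kF : k%:R <= k`!%:R :> R.
  by rewrite ler_nat; case: {+}k => // m; rewrite factS leq_pmulr ?fact_gt0.
have {}Sr : k`!%:R ^+ 3 <= r%:R :> R by rewrite -natrX ler_nat.
rewrite factS natrM -natr1 invfM; move: Sr kF F0 k0 Lk.
set F : R := k`!%:R; set c : R := k%:R; set p : R := r%:R => Sr kF F0 k0 Lk.
(* After division by [p], the right side is [q] and the left side is [2 * L + 2 * L * u ^+ 2 * q].
   The first term is below [q / 2] because [4 * L < c <= F <= q], and the second is at most [q / 2]
   by [Lu]. *)
pose q := p / F ^+ 2; pose u := (c + 1)^-1.
have F20 : 0 < F ^+ 2 by rewrite exprn_gt0.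
have Fq : F <= q by rewrite /q ler_pdivlMr// -exprS.
have q0 : 0 < q := lt_le_trans F0 Fq.
have pE : p = q * F ^+ 2 by rewrite /q divfK// gt_eqF.
have u0 : 0 < u by rewrite invr_gt0 addr_gt0.
have Lu : 4 * L * u ^+ 2 <= 1.
  rewrite /u exprVn ler_pdivrMr ?exprn_gt0 ?addr_gt0// mul1r.
  by apply: le_trans (ltW Lk) _; nra.
rewrite [ltRHS](_ : _ = p * q); last first.
  by rewrite pE; field; rewrite gt_eqF.
rewrite [ltLHS](_ : _ = p * (2 * L + 2 * L * u ^+ 2 * q)); last first.
  by rewrite pE /u; field; rewrite !gt_eqF ?addr_gt0.
rewrite ltr_pM2l; last by rewrite pE mulr_gt0.
have := ler_wpM2r (ltW q0) Lu; rewrite mul1r; lra.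
Qed.

End Weight.

(** * Assembly of the two spaces and choice of a late block *)

Theorem theorem1p9 (R : realType) :
  exists X Y : opSpace R,
    [/\ separable X /\ hilbertian X,
        separable Y /\ hilbertian Y,
        completely_isometrically_embeds (@os_norm R X) (@c0_norm R Y) &
        ~ completely_isomorphically_embeds (@os_norm R X) (@os_norm R Y)].
Proof.
have a01 := @weight01 R.
exists (spaceX a01), (spaceY a01); split.
- by split; [exact: ell2_separable|exact: rc_hilbertian].
- by split; [exact: ell2_separable|exact: rc_hilbertian].
- by exists (@c0_embed R _ a01); exact: c0_embed_isometry.
move=> [f [_ [K fK] [g gfK [K' gK']]]].
pose L := K' ^+ 2 * K ^+ 2.
have L0 : 0 <= L by rewrite mulr_ge0 ?sqr_ge0.
(* The block index is chosen by the Archimedean property, after the embedding constants are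
   known. *)
pose k := Num.bound (4 * L).
have Lk : 4 * L < k%:R by apply: archi_boundP; rewrite mulr_ge0.
have f_cb n (x : 'M[spaceX a01]_n) :
    @os_norm R (spaceY a01) n (map_mx f x) <= K * os_norm x by exact: fK.
have g_cb n (x : 'M[spaceX a01]_n) :
    os_norm x <= K' * @os_norm R (spaceY a01) n (map_mx f x).
  (* Writing [x] as the image of [map_mx f x] under [g] lets the bound for the inverse, which holds
     on matrices over the range of [f], apply. *)
  have {1}<- : map_mx g (map_mx f x) = x by apply/matrixP => i j; rewrite !mxE gfK.
  by apply: gK' => i j; rewrite mxE; exact: imageT.
have alpha0 : 0 <= (k`!%:R)^-1 :> R by rewrite invr_ge0.
have beta0 : 0 <= (k.+1`!%:R)^-1 :> R by rewrite invr_ge0.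
have [r Sr] := no_embedding f_cb g_cb alpha0 beta0
  (fun n => @weight_ge R n k) (fun n => @weight_le R n k).
have := weight_gap L0 Lk Sr; rewrite ltNge => /negP gap le_r; apply: gap.
by apply: le_trans le_r _; rewrite /L !mulrA.
Qed.
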